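(* Let $q_{\mathrm B}=e^{\pi\mathrm i/6}$ and $r=q_{\mathrm B}^3=\mathrm i$. For every oriented link $L$, $$\widetilde T_3(L)=K_L(r,q_{\mathrm B})=V_L(q_{\mathrm B}^{-2})^2.$$
   Context: Let $\omega=e^{2\pi\mathrm i/3}$ and let $V=\mathbb C^3$ have orthonormal basis $e_x$, $x\in\mathbb F_3$. $R_3$ is the unitary Yang--Baxter operator $$R_3(e_x\otimes e_y)=3^{-1/2}\sum_{t\in\mathbb F_3}\omega^{t^2+t-(x+y)^2+(x+y)}\,e_{x+t}\otimes e_{y-t},$$ and $\rho_{R_3,n}(\sigma_i)=I^{\otimes(i-1)}\otimes R_3\otimes I^{\otimes(n-i-1)}$ is the associated representation of the braid group $\mathcal B_n$. Let $L=\widehat\xi$ be the closure of $\xi\in\mathcal B_n$ with writhe (exponent sum) $w$. Each of the following is a well-defined oriented link invariant. (1) $T_3(L)=q_{\mathrm B}^{-w}\,\mathrm{Tr}(\rho_{R_3,n}(\xi))$ and $\widetilde T_3(L)=\frac13T_3(L)$. (2) $K_L(r,q_{\mathrm B})=3^{n-1}r^{-w}\,\mathrm{tr}_n^{\mathrm{BMW}}(G_\xi)$, the BMW/Kauffman invariant, where $G_\xi$ is the image of $\xi$ under $\sigma_i\mapsto g_i$ in the BMW algebra $C_n(r,q_{\mathrm B})$: the unital complex algebra generated by invertible $g_i$ and $e_i$, $1\le i<n$, with the braid relations for the $g_i$, $g_i-g_i^{-1}=(q_{\mathrm B}-q_{\mathrm B}^{-1})(1-e_i)$, $e_ig_i=r^{-1}e_i$,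 $e_ig_{i\pm1}^{\epsilon}e_i=r^\epsilon e_i$ ($\epsilon=\pm1$); $\mathrm{tr}^{\mathrm{BMW}}_n$ is its normalized Markov trace: $\mathrm{tr}_n(1)=1$, $\mathrm{tr}_n(ab)=\mathrm{tr}_n(ba)$, $\mathrm{tr}_{n+1}(ag_n^{\pm1})=\frac{r^{\pm1}}3\mathrm{tr}_n(a)$, $\mathrm{tr}_{n+1}(ae_n)=\frac13\mathrm{tr}_n(a)$. (3) $V_L(q_{\mathrm B}^{-2})=(q_{\mathrm B}+q_{\mathrm B}^{-1})^{n-1}(-q_{\mathrm B}^{-1})^w\,\mathrm{tr}_n^{\mathrm{TL}}(g_\xi)$, the Jones polynomial at $q_{\mathrm B}^{-2}=e^{-\pi\mathrm i/3}$ normalized by $V_\bigcirc=1$ (with square root $-q_{\mathrm B}^{-1}$ of $q_{\mathrm B}^{-2}$). Here the Temperley--Lieb algebra is generated by idempotents $p_i$, $1\le i<n$, with $p_ip_{i\pm1}p_i=(q_{\mathrm B}+q_{\mathrm B}^{-1})^{-2}p_i$ and $p_ip_j=p_jp_i$ for $|i-j|>1$; $g_\xi$ is the image of $\xi$ under $\sigma_i\mapsto-1+(1+q_{\mathrm B}^{-2})p_i$; and $\mathrm{tr}^{\mathrm{TL}}_n$ is the normalized Markov trace, $\mathrm{tr}_n(1)=1$, $\mathrm{tr}_n(ab)=\mathrm{tr}_n(ba)$, $\mathrm{tr}_{n+1}(ap_n)=(q_{\mathrm B}+q_{\mathrm B}^{-1})^{-2}\mathrm{tr}_n(a)$. *)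

(* Defs.v *)
From HB Require Import structures.
From mathcomp Require Import all_boot all_order all_algebra.
From mathcomp Require Import generic_quotient complex.
From mathcomp Require Import boolp reals trigo ring.

Set Implicit Arguments.
Unset Strict Implicit.
Unset Printing Implicit Defensive.

Import Order.TTheory GRing.Theory Num.Theory.
Local Open Scope ring_scope.
Local Open Scope complex_scope.
Local Open Scope quotient_scope.

(* Formal noncommutative expressions; [Cst c] stands for c times the unit, so
   that scaling is multiplication by a constant. *)
Inductive expr (K X : Type) : Type :=
| Cst (c : K)
| Gen (x : X)
| Add (u v : expr K X)
| Mul (u v : expr K X).
Arguments Cst {K X} c.
Arguments Gen {K X} x.

HB.instance Definition _ (K X : Type) := gen_eqMixin (expr K X).
HB.instance Definition _ (K X : Type) := gen_choiceMixin (expr K X).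

Declare Scope expr_scope.
Delimit Scope expr_scope with EX.
Bind Scope expr_scope with expr.
Notation "u + v" := (Add u v) : expr_scope.
Notation "u * v" := (Mul u v) : expr_scope.

(* The smallest congruence that contains [rel] and whose quotient is a unital
   associative K-algebra. *)
Inductive cong (K : comPzRingType) (X : Type)
    (rel : expr K X -> expr K X -> Prop) : expr K X -> expr K X -> Prop :=
| cong_rel u v : rel u v -> cong rel u v
| cong_refl u : cong rel u u
| cong_sym u v : cong rel u v -> cong rel v u
| cong_trans u v w : cong rel u v -> cong rel v w -> cong rel u w
| cong_add u u' v v' :
    cong rel u u' -> cong rel v v' -> cong rel (u + v)%EX (u' + v')%EX
| cong_mul u u' v v' :
    cong rel u u' -> cong rel v v' -> cong rel (u * v)%EX (u' * v')%EX
| cong_addA u v w : cong rel (u + (v + w))%EX (u + v + w)%EX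
| cong_addC u v : cong rel (u + v)%EX (v + u)%EX
| cong_add0 u : cong rel (Cst 0 + u)%EX u
| cong_mulA u v w : cong rel (u * (v * w))%EX (u * v * w)%EX
| cong_mul1 u : cong rel (Cst 1 * u)%EX u
| cong_mul0 u : cong rel (Cst 0 * u)%EX (Cst 0)
| cong_mulDl u v w : cong rel ((u + v) * w)%EX (u * w + v * w)%EX
| cong_mulDr u v w : cong rel (u * (v + w))%EX (u * v + u * w)%EX
| cong_cstD a b : cong rel (Cst a + Cst b)%EX (Cst (a + b))
| cong_cstM a b : cong rel (Cst a * Cst b)%EX (Cst (a * b))
| cong_cstC a u : cong rel (Cst a * u)%EX (u * Cst a)%EX.

Section PresentedAlgebra.
Variables (K : comPzRingType) (X : Type) (rel : expr K X -> expr K X -> Prop).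

Definition congb (u v : expr K X) : bool := `[< cong rel u v >].

Lemma congb_refl : reflexive congb.
Proof. by move=> u; apply/asboolP/cong_refl. Qed.

Lemma congb_sym : symmetric congb.
Proof. by move=> u v; apply/asboolP/asboolP => /cong_sym. Qed.

Lemma congb_trans : transitive congb.
Proof.
by move=> v u w /asboolP uv /asboolP vw; apply/asboolP/(cong_trans uv vw).
Qed.

Canonical cong_equiv := EquivRel congb congb_refl congb_sym congb_trans.

Definition presAlg : Type := {eq_quot cong_equiv}.
HB.instance Definition _ := Choice.on presAlg.
HB.instance Definition _ := EqQuotient.on presAlg.

Definition pcls (u : expr K X) : presAlg := \pi_presAlg u.
Definition pgen (x : X) : presAlg := pcls (Gen x).
Definition pcst (c : K) : presAlg := pcls (Cst c).

Lemma pclsP (u v : expr K X) : pcls u = pcls v <-> cong rel u v.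
Proof.
split=> [/eqquotP/asboolP //|uv].
by apply/eqquotP/asboolP.
Qed.

Lemma repr_pcls (u : expr K X) : cong rel (repr (pcls u)) u.
Proof. by apply/pclsP; rewrite /pcls reprK. Qed.

Lemma pclsK (a : presAlg) : pcls (repr a) = a.
Proof. exact: reprK. Qed.

Definition padd (a b : presAlg) : presAlg := pcls (repr a + repr b)%EX.
Definition pmul (a b : presAlg) : presAlg := pcls (repr a * repr b)%EX.
Definition popp (a : presAlg) : presAlg := pcls (Cst (-1) * repr a)%EX.
Definition pscale (c : K) (a : presAlg) : presAlg := pcls (Cst c * repr a)%EX.

Lemma paddE u v : padd (pcls u) (pcls v) = pcls (u + v)%EX.
Proof. by apply/pclsP/cong_add; exact: repr_pcls. Qed.

Lemma pmulE u v : pmul (pcls u) (pcls v) = pcls (u * v)%EX.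
Proof. by apply/pclsP/cong_mul; exact: repr_pcls. Qed.

Lemma poppE u : popp (pcls u) = pcls (Cst (-1) * u)%EX.
Proof. by apply/pclsP/cong_mul; [exact: cong_refl|exact: repr_pcls]. Qed.

Lemma pscaleE c u : pscale c (pcls u) = pcls (Cst c * u)%EX.
Proof. by apply/pclsP/cong_mul; [exact: cong_refl|exact: repr_pcls]. Qed.

Let elimP (P : presAlg -> Prop) : (forall u, P (pcls u)) -> forall a, P a.
Proof. by move=> Pu a; rewrite -(pclsK a). Qed.

Lemma paddA : associative padd.
Proof.
elim/elimP=> u; elim/elimP=> v; elim/elimP=> w.
by rewrite !paddE; apply/pclsP/cong_addA.
Qed.

Lemma paddC : commutative padd.
Proof.
by elim/elimP=> u; elim/elimP=> v; rewrite !paddE; apply/pclsP/cong_addC.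
Qed.

Lemma padd0 : left_id (pcst 0) padd.
Proof. by elim/elimP=> u; rewrite paddE; apply/pclsP/cong_add0. Qed.

Lemma paddN : left_inverse (pcst 0) popp padd.
Proof.
elim/elimP=> u; rewrite poppE paddE; apply/pclsP.
apply: cong_trans (cong_mul0 rel u).
apply: (@cong_trans _ _ _ _ (Cst (-1) * u + Cst 1 * u)%EX).
  by apply: cong_add; [exact: cong_refl|exact/cong_sym/cong_mul1].
apply: cong_trans (cong_sym (cong_mulDl rel _ _ _)) _.
apply: cong_mul; last exact: cong_refl.
by have := cong_cstD rel (-1) 1; rewrite addNr.
Qed.

HB.instance Definition _ :=
  GRing.isZmodule.Build presAlg paddA paddC padd0 paddN.

Lemma pmulA : associative pmul.
Proof.
elim/elimP=> u; elim/elimP=> v; elim/elimP=> w.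
by rewrite !pmulE; apply/pclsP/cong_mulA.
Qed.

Lemma pmul1 : left_id (pcst 1) pmul.
Proof. by elim/elimP=> u; rewrite pmulE; apply/pclsP/cong_mul1. Qed.

Lemma pmulr1 : right_id (pcst 1) pmul.
Proof.
elim/elimP=> u; rewrite pmulE; apply/pclsP.
exact: cong_trans (cong_sym (cong_cstC _ _ _)) (cong_mul1 _ _).
Qed.

Lemma pmulDl : left_distributive pmul padd.
Proof.
elim/elimP=> u; elim/elimP=> v; elim/elimP=> w.
by rewrite !(pmulE, paddE); apply/pclsP/cong_mulDl.
Qed.

Lemma pmulDr : right_distributive pmul padd.
Proof.
elim/elimP=> u; elim/elimP=> v; elim/elimP=> w.
by rewrite !(pmulE, paddE); apply/pclsP/cong_mulDr.
Qed.

HB.instance Definition _ :=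
  GRing.Zmodule_isPzRing.Build presAlg pmulA pmul1 pmulr1 pmulDl pmulDr.

Lemma pscaleA (a b : K) (v : presAlg) :
  pscale a (pscale b v) = pscale (a * b) v.
Proof.
elim/elimP: v => u; rewrite !pscaleE; apply/pclsP.
apply: cong_trans (cong_mulA _ _ _ _) _.
by apply: cong_mul; [exact: cong_cstM|exact: cong_refl].
Qed.

Lemma pscale1 : left_id 1 pscale.
Proof. by elim/elimP=> u; rewrite pscaleE; apply/pclsP/cong_mul1. Qed.

Lemma pscaleDr : right_distributive pscale padd.
Proof.
move=> c; elim/elimP=> u; elim/elimP=> v.
by rewrite !(pscaleE, paddE); apply/pclsP/cong_mulDr.
Qed.

Lemma pscaleDl (v : presAlg) : {morph pscale^~ v : a b / a + b >-> padd a b}.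
Proof.
elim/elimP: v => u a b /=; rewrite !(pscaleE, paddE); apply/pclsP.
apply: cong_trans (cong_mulDl _ _ _ _).
by apply: cong_mul; [exact/cong_sym/cong_cstD|exact: cong_refl].
Qed.

HB.instance Definition _ := GRing.Zmodule_isLmodule.Build K presAlg
  pscaleA pscale1 pscaleDr pscaleDl.

Lemma pclsD u v : pcls (u + v)%EX = pcls u + pcls v.
Proof. by rewrite -paddE. Qed.

Lemma pclsM u v : pcls (u * v)%EX = pcls u * pcls v.
Proof. by rewrite -pmulE. Qed.

Lemma pclsC c : pcls (Cst c) = c *: (1 : presAlg).
Proof.
rewrite [RHS](pscaleE c (Cst 1)); apply/pclsP/cong_sym.
by rewrite -[X in cong _ _ (Cst X)]mulr1; exact: cong_cstM.
Qed.

Lemma presAlg_scaleAl c (a b : presAlg) : c *: (a * b) = c *: a * b.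
Proof.
elim/elimP: a => u; elim/elimP: b => v.
by rewrite -pclsM [LHS]pscaleE [X in X * _](pscaleE c u) -pclsM;
  apply/pclsP/cong_mulA.
Qed.

Lemma presAlg_scaleAr c (a b : presAlg) : c *: (a * b) = a * (c *: b).
Proof.
elim/elimP: a => u; elim/elimP: b => v.
rewrite -pclsM [LHS]pscaleE [X in _ * X](pscaleE c v) -pclsM.
apply/pclsP; apply: cong_trans (cong_mulA _ _ _ _) _.
apply: cong_trans (cong_sym (cong_mulA _ _ _ _)).
by apply: cong_mul; [exact: cong_cstC|exact: cong_refl].
Qed.

End PresentedAlgebra.

Fixpoint emap (K X Y : Type) (f : X -> Y) (u : expr K X) : expr K Y :=
  match u with
  | Cst c => Cst c
  | Gen x => Gen (f x)
  | Add u v => (emap f u + emap f v)%EX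
  | Mul u v => (emap f u * emap f v)%EX
  end.

Section InducedMorphism.
Variables (K : comPzRingType) (X Y : Type).
Variables (rX : expr K X -> expr K X -> Prop).
Variables (rY : expr K Y -> expr K Y -> Prop).
Variable f : X -> Y.

(* An algebra morphism as soon as [f] sends relations to relations ([phomE]). *)
Definition phom (a : presAlg rX) : presAlg rY := pcls rY (emap f (repr a)).

Hypothesis f_rel : forall u v, rX u v -> cong rY (emap f u) (emap f v).

Lemma emap_cong u v : cong rX u v -> cong rY (emap f u) (emap f v).
Proof.
elim=> /=; try by move=> *; constructor.
- exact: f_rel.
- by move=> *; apply: cong_trans; eassumption.
Qed.

Lemma phomE u : phom (pcls rX u) = pcls rY (emap f u).
Proof. by apply/pclsP/emap_cong/repr_pcls. Qed.

End InducedMorphism.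

(* Braids on n strands are words in the n - 1 Artin generators: the letter
   [(i, true)] is sigma_(i+1) and [(i, false)] its inverse. *)
Definition braid (n : nat) : Type := seq ('I_n.-1 * bool).

Definition writhe (n : nat) (xi : braid n) : int :=
  \sum_(s <- xi) (if s.2 then 1 else -1).

(* Image of a braid word once the images of the generators ([f]) and of their
   inverses ([f']) are given. *)
Definition braid_image (A : pzRingType) (n : nat) (f f' : 'I_n.-1 -> A)
    (xi : braid n) : A :=
  \prod_(s <- xi) (if s.2 then f s.1 else f' s.1).

Definition adjacent (m : nat) (i j : 'I_m) : bool :=
  (i.+1 == j :> nat) || (j.+1 == i :> nat).

Definition far (m : nat) (i j : 'I_m) : bool :=
  (i.+1 < j)%N || (j.+1 < i)%N.

Inductive bmw_gen (n : nat) : Type :=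
| BmwG (i : 'I_n.-1)
| BmwGinv (i : 'I_n.-1)
| BmwE (i : 'I_n.-1).

Section BMW.
Variables (K : fieldType) (r q : K).

Inductive bmw_rel (n : nat) :
    expr K (bmw_gen n) -> expr K (bmw_gen n) -> Prop :=
| bmw_gV i : bmw_rel (Gen (BmwG i) * Gen (BmwGinv i))%EX (Cst 1)
| bmw_Vg i : bmw_rel (Gen (BmwGinv i) * Gen (BmwG i))%EX (Cst 1)
| bmw_braid i j : adjacent i j ->
    bmw_rel (Gen (BmwG i) * Gen (BmwG j) * Gen (BmwG i))%EX
            (Gen (BmwG j) * Gen (BmwG i) * Gen (BmwG j))%EX
| bmw_comm i j : far i j ->
    bmw_rel (Gen (BmwG i) * Gen (BmwG j))%EX (Gen (BmwG j) * Gen (BmwG i))%EX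
| bmw_skein i :
    bmw_rel (Gen (BmwG i) + Cst (-1) * Gen (BmwGinv i))%EX
            (Cst (q - q^-1) * (Cst 1 + Cst (-1) * Gen (BmwE i)))%EX
| bmw_eg i :
    bmw_rel (Gen (BmwE i) * Gen (BmwG i))%EX (Cst r^-1 * Gen (BmwE i))%EX
| bmw_ege i j : adjacent i j ->
    bmw_rel (Gen (BmwE i) * Gen (BmwG j) * Gen (BmwE i))%EX
            (Cst r * Gen (BmwE i))%EX
| bmw_eVe i j : adjacent i j ->
    bmw_rel (Gen (BmwE i) * Gen (BmwGinv j) * Gen (BmwE i))%EX
            (Cst r^-1 * Gen (BmwE i))%EX.

Definition bmw (n : nat) := presAlg (@bmw_rel n).

Definition bmw_g n (i : 'I_n.-1) : bmw n := pgen (@bmw_rel n) (BmwG i).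
Definition bmw_ginv n (i : 'I_n.-1) : bmw n := pgen (@bmw_rel n) (BmwGinv i).
Definition bmw_e n (i : 'I_n.-1) : bmw n := pgen (@bmw_rel n) (BmwE i).

Definition bmw_widen n (x : bmw_gen n) : bmw_gen n.+1 :=
  match x with
  | BmwG i => @BmwG n.+1 (widen_ord (leq_pred n) i)
  | BmwGinv i => @BmwGinv n.+1 (widen_ord (leq_pred n) i)
  | BmwE i => @BmwE n.+1 (widen_ord (leq_pred n) i)
  end.

Definition bmw_incl n : bmw n -> bmw n.+1 :=
  phom (@bmw_rel n.+1) (@bmw_widen n).

Lemma bmw_widen_rel n u v : @bmw_rel n u v ->
  cong (@bmw_rel n.+1) (emap (@bmw_widen n) u) (emap (@bmw_widen n) v).
Proof. by case=> *; apply: cong_rel; constructor. Qed.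

(* [ord_max] is the index of the last generator of [bmw n.+2]. *)
Record bmw_markov_trace (tr : forall n, {scalar bmw n}) : Prop := {
  bmw_tr1 : forall n, tr n.+1 1 = 1;
  bmw_trC : forall n (a b : bmw n.+1), tr n.+1 (a * b) = tr n.+1 (b * a);
  bmw_trg : forall n (a : bmw n.+1),
    tr n.+2 (bmw_incl a * @bmw_g n.+2 ord_max) = r / 3%:R * tr n.+1 a;
  bmw_trginv : forall n (a : bmw n.+1),
    tr n.+2 (bmw_incl a * @bmw_ginv n.+2 ord_max) = r^-1 / 3%:R * tr n.+1 a;
  bmw_tre : forall n (a : bmw n.+1),
    tr n.+2 (bmw_incl a * @bmw_e n.+2 ord_max) = 3%:R^-1 * tr n.+1 a
}.

Definition kauffman (tr : forall n, {scalar bmw n}) n (xi : braid n.+1) : K :=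
  3%:R ^+ n * r ^ (- writhe xi) *
  tr n.+1 (braid_image (@bmw_g n.+1) (@bmw_ginv n.+1) xi).

End BMW.

Section TemperleyLieb.
Variables (K : fieldType) (q : K).

Inductive tl_rel (n : nat) : expr K 'I_n.-1 -> expr K 'I_n.-1 -> Prop :=
| tl_idem i : tl_rel (Gen i * Gen i)%EX (Gen i)
| tl_pjp i j : adjacent i j ->
    tl_rel (Gen i * Gen j * Gen i)%EX (Cst ((q + q^-1) ^- 2) * Gen i)%EX
| tl_comm i j : far i j -> tl_rel (Gen i * Gen j)%EX (Gen j * Gen i)%EX.

Definition tl (n : nat) := presAlg (@tl_rel n).

Definition tl_p n (i : 'I_n.-1) : tl n := pgen (@tl_rel n) i.

Definition tl_g n (i : 'I_n.-1) : tl n := - 1 + (1 + q ^- 2) *: tl_p i.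

(* The inverse of [tl_g i], see [tl_gV] and [tl_Vg]. *)
Definition tl_ginv n (i : 'I_n.-1) : tl n := - 1 + (1 + q ^+ 2) *: tl_p i.

Definition tl_incl n : tl n -> tl n.+1 :=
  phom (@tl_rel n.+1) (widen_ord (leq_pred n)).

Lemma tl_widen_rel n u v : @tl_rel n u v ->
  cong (@tl_rel n.+1) (emap (widen_ord (leq_pred n)) u)
                      (emap (widen_ord (leq_pred n)) v).
Proof. by case=> *; apply: cong_rel; constructor. Qed.

Lemma tl_pp n (i : 'I_n.-1) : tl_p i * tl_p i = tl_p i.
Proof. by rewrite -pclsM; apply/pclsP/cong_rel/tl_idem. Qed.

Lemma tl_affineM n (i : 'I_n.-1) (a b : K) : a * b = a + b ->
  (- 1 + a *: tl_p i) * (- 1 + b *: tl_p i) = 1.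
Proof.
move=> ab; rewrite mulrDl !mulrDr !mulN1r mulrN1 opprK.
rewrite -presAlg_scaleAl -presAlg_scaleAr tl_pp scalerA ab scalerDl.
by rewrite addKr subrK.
Qed.

Lemma tl_gV n (i : 'I_n.-1) : q != 0 -> tl_g i * tl_ginv i = 1.
Proof.
by move=> q0; apply: tl_affineM; field.
Qed.

Lemma tl_Vg n (i : 'I_n.-1) : q != 0 -> tl_ginv i * tl_g i = 1.
Proof.
by move=> q0; apply: tl_affineM; field.
Qed.

Record tl_markov_trace (tr : forall n, {scalar tl n}) : Prop := {
  tl_tr1 : forall n, tr n.+1 1 = 1;
  tl_trC : forall n (a b : tl n.+1), tr n.+1 (a * b) = tr n.+1 (b * a);
  tl_trp : forall n (a : tl n.+1),
    tr n.+2 (tl_incl a * @tl_p n.+2 ord_max) = (q + q^-1) ^- 2 * tr n.+1 a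
}.

(* The Jones polynomial at q^-2, for the square root - q^-1 of q^-2. *)
Definition jones (tr : forall n, {scalar tl n}) n (xi : braid n.+1) : K :=
  (q + q^-1) ^+ n * (- q^-1) ^ (writhe xi) *
  tr n.+1 (braid_image (@tl_g n.+1) (@tl_ginv n.+1) xi).

End TemperleyLieb.

Section YangBaxter.
Variable R : realType.
Local Notation C := R[i].

Definition expi (t : R) : C := cos t +i* sin t.

Definition omega : C := expi (2 * pi / 3).
Definition qB : C := expi (pi / 6).
Definition rB : C := qB ^+ 3.

Lemma expiD (s t : R) : expi (s + t) = expi s * expi t.
Proof. by rewrite /expi cosD sinD; congr (_ +i* _); rewrite addrC. Qed.

Lemma rBE : rB = 'i.
Proof.
rewrite /rB /qB !exprS expr0 mulr1 -!expiD.
have -> : pi / 6 + (pi / 6 + pi / 6) = pi / 2 :> R by field.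
by rewrite /expi cos_pihalf sin_pihalf.
Qed.

(* The coefficient of e_a (x) e_b in R_3 (e_x (x) e_y). The exponent of omega is
   computed in F_3. *)
Definition R3 (a b x y : 'F_3) : C :=
  ((Num.sqrt 3)^-1)%:C *
  \sum_(t : 'F_3 | (a == x + t) && (b == y - t))
    omega ^+ (t ^+ 2 + t - (x + y) ^+ 2 + (x + y) : 'F_3)%R.

(* The basis of the tensor power of n.+1 copies of V is indexed by the maps from
   'I_n.+1 to F_3, which are enumerated to index rows and columns. *)
Definition site (n : nat) : finType := {ffun 'I_n.+1 -> 'F_3}.

Definition R3_at n (i : 'I_n) : 'M[C]_#|site n| :=
  let l : 'I_n.+1 := widen_ord (leqnSn n) i in
  let l' : 'I_n.+1 := lift ord0 i in
  \matrix_(u, v)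
    let a : site n := enum_val u in
    let x : site n := enum_val v in
    if [forall k, (k != l) && (k != l') ==> (a k == x k)]
    then R3 (a l) (a l') (x l) (x l') else 0.

Definition rhoR3 n (xi : braid n.+1) : 'M[C]_#|site n| :=
  braid_image (@R3_at n : 'I_n.+1.-1 -> _) (fun i => invmx (R3_at i)) xi.

Definition T3 n (xi : braid n.+1) : C := qB ^ (- writhe xi) * \tr (rhoR3 xi).

Definition T3tilde n (xi : braid n.+1) : C := 3%:R^-1 * T3 xi.

End YangBaxter.

(* Main.v *)
(* The operator R_3 acting on the strands i, i+1 is
   q^-1 G_i G'_i with G_i = -1 + (1 + q^-2) p_i and G'_i = -1 + (1 + q^-2) p'_i.
   Here p_i and p'_i are the averages over the powers of two order 3 operators
   on (C^3)^(x)n, a shift e_x (x) e_y -> w e_(x+1) (x) e_(y-1) and a phase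
   e_x (x) e_y -> w^(1+x+y) e_x (x) e_y, whose roles are exchanged at every step
   of i. The p_i and the p'_i form two commuting Temperley-Lieb families with
   loop value q + 1/q, where (q + 1/q)^2 = 3, and the normalized matrix trace is
   Markov for both and multiplicative between them. Moreover g_i = q G_i G'_i and
   e_i = 3 p_i p'_i satisfy the BMW relations with r = q^3. Since every element
   of the BMW (or Temperley-Lieb) algebra on n+1 strands is a combination of
   elements a and a x b, with a, b on n strands and x a last generator, Markov
   traces are unique, so the trace of the braid matrix computes both sides. *)
Require Import Defs.
From mathcomp Require Import all_boot all_order all_algebra.
From mathcomp Require Import complex reals trigo ring lra zify.

Set Implicit Arguments.
Unset Strict Implicit.
Unset Printing Implicit Defensive.

Import Order.TTheory GRing.Theory Num.Theory.
Local Open Scope ring_scope.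

(** Why the roles alternate: shifts commute with shifts and phases with phases, while a shift and a
    phase fail to commute only on neighbouring pairs of strands, because x + y is invariant under
    (x, y) -> (x + 1, y - 1). Alternating the kinds puts all noncommutation inside one family. Why
    R_3 is a product: its exponent is a function of t plus a function of x + y. The first is the
    coefficient sequence of the shift factor; the second comes from the Fourier transform of that
    sequence, which is the spectrum of the phase factor. Why the scalars agree: for writhe k the
    three invariants carry q^-k q^-k, q^(-3k) q^k and (-q^-1)^(2k), all equal to q^(-2k). The main
    obstacle: a Markov trace is given only by its values next to a last generator, so its
    compatibility with the inclusions has to be derived. Injectivity of the inclusions is avoided by
    proving the normal form inside a single algebra. The algebra is done over any field with q^4 =
    q^2 - 1 and 3 != 0; the complex numbers enter only at the end. *)

Lemma mx_scalerAl (K : comPzRingType) N c (a b : 'M[K]_N) : c *: (a * b) = c *: a * b.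
Proof. exact: scalemxAl. Qed.

Lemma mx_scalerAr (K : comPzRingType) N c (a b : 'M[K]_N) : c *: (a * b) = a * (c *: b).
Proof. exact: scalemxAr. Qed.

(** * Presented algebras *)

Section Evaluation.
Variables (K : comPzRingType) (X : Type) (N : nat) (phi : X -> 'M[K]_N).

Fixpoint ev (u : expr K X) : 'M[K]_N :=
  match u with
  | Cst c => c%:M
  | Gen x => phi x
  | Add u v => ev u + ev v
  | Mul u v => ev u * ev v
  end.

Variable rel : expr K X -> expr K X -> Prop.

(** Defined through a representative, hence total; it is an algebra morphism once [phi_rel]
    holds. *)
Definition pev (a : presAlg rel) : 'M[K]_N := ev (repr a).

Hypothesis phi_rel : forall u v, rel u v -> ev u = ev v.

Lemma ev_cong u v : cong rel u v -> ev u = ev v.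
Proof.
elim=> {u v} /=.
- exact: phi_rel.
- by [].
- by [].
- by move=> u v w _ -> _ ->.
- by move=> u u' v v' _ -> _ ->.
- by move=> u u' v v' _ -> _ ->.
- by move=> *; rewrite addrA.
- by move=> *; rewrite addrC.
- by move=> *; rewrite raddf0 add0r.
- by move=> *; rewrite mulrA.
- by move=> *; rewrite mul1r.
- by move=> *; rewrite raddf0 mul0r.
- by move=> *; rewrite mulrDl.
- by move=> *; rewrite mulrDr.
- by move=> *; rewrite raddfD.
- by move=> *; rewrite scalar_mxM.
- by move=> *; exact/esym/scalar_mxC.
Qed.

Lemma pevE u : pev (pcls rel u) = ev u.
Proof. exact/ev_cong/repr_pcls. Qed.

Lemma pev_gen x : pev (pgen rel x) = phi x.
Proof. exact: pevE. Qed.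

Lemma pev1 : pev 1 = 1.
Proof. by exact: (pevE (Cst 1)). Qed.

Lemma pevD a b : pev (a + b) = pev a + pev b.
Proof. by rewrite -(pclsK a) -(pclsK b) -pclsD !pevE. Qed.

Lemma pevM a b : pev (a * b) = pev a * pev b.
Proof. by rewrite -(pclsK a) -(pclsK b) -pclsM !pevE. Qed.

Lemma pevZ c a : pev (c *: a) = c *: pev a.
Proof.
by rewrite -{1}(mul1r a) presAlg_scaleAl pevM -pclsC pevE; exact: mul_scalar_mx.
Qed.

End Evaluation.

Lemma presAlg_ind (K : comPzRingType) X (rel : expr K X -> expr K X -> Prop)
    (P : presAlg rel -> Prop) :
  (forall c, P (c *: (1 : presAlg rel))) -> (forall x, P (pgen rel x)) ->
  (forall a b, P a -> P b -> P (a + b)) ->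
  (forall a b, P a -> P b -> P (a * b)) -> forall a, P a.
Proof.
move=> Pc Px PD PM a; rewrite -(pclsK a).
elim: (repr a) => [c|x|u Pu v Pv|u Pu v Pv].
- by rewrite pclsC.
- exact: Px.
- by rewrite pclsD; exact: PD.
- by rewrite pclsM; exact: PM.
Qed.

Lemma eq_ev (K : comPzRingType) X N (f g : X -> 'M[K]_N) : f =1 g -> ev f =1 ev g.
Proof. by move=> fg; elim=> //= u -> v ->. Qed.

Lemma ev_emap (K : comPzRingType) X Y N (f : X -> Y) (phi : Y -> 'M[K]_N) u :
  ev phi (emap f u) = ev (phi \o f) u.
Proof. by elim: u => //= u -> v ->. Qed.

Section InducedMorphismTheory.
Variables (K : comPzRingType) (X Y : Type).
Variables (rX : expr K X -> expr K X -> Prop).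
Variables (rY : expr K Y -> expr K Y -> Prop).
Variable f : X -> Y.
Hypothesis f_rel : forall u v, rX u v -> cong rY (emap f u) (emap f v).
Local Notation ph := (@phom K X Y rX rY f).

Lemma phomD a b : ph (a + b) = ph a + ph b.
Proof. by rewrite -(pclsK a) -(pclsK b) -pclsD !(phomE f_rel) -pclsD. Qed.

Lemma phomM a b : ph (a * b) = ph a * ph b.
Proof. by rewrite -(pclsK a) -(pclsK b) -pclsM !(phomE f_rel) -pclsM. Qed.

Lemma phom1 : ph 1 = 1.
Proof. exact: (phomE f_rel (Cst 1)). Qed.

Lemma phomZ c a : ph (c *: a) = c *: ph a.
Proof.
rewrite -{1}(mul1r a) presAlg_scaleAl phomM -pclsC (phomE f_rel) /= pclsC.
by rewrite -presAlg_scaleAl mul1r.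
Qed.

Lemma phom_gen x : ph (pgen rX x) = pgen rY (f x).
Proof. exact: (phomE f_rel). Qed.

Lemma pev_phom N (phi : Y -> 'M[K]_N) a :
  (forall u v, rY u v -> ev phi u = ev phi v) ->
  pev phi (ph a) = pev (phi \o f) a.
Proof. by move=> phi_rel; rewrite /phom pevE // ev_emap. Qed.

End InducedMorphismTheory.

(** * Normal forms in a tower of algebras *)

Section Spans.
Variables (K : comPzRingType) (X : Type) (rel : expr K X -> expr K X -> Prop).
Local Notation A := (presAlg rel).

Inductive subalg (P : A -> Prop) : A -> Prop :=
| subalg_cst c : subalg P (c *: (1 : A))
| subalg_gen x : P x -> subalg P x
| subalg_add x y : subalg P x -> subalg P y -> subalg P (x + y)
| subalg_mul x y : subalg P x -> subalg P y -> subalg P (x * y).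

Inductive lspan (P : A -> Prop) : A -> Prop :=
| lspan_scale c x : P x -> lspan P (c *: x)
| lspan_add x y : lspan P x -> lspan P y -> lspan P (x + y).

Lemma subalg1 P : subalg P 1.
Proof. by rewrite -(scale1r (1 : A)); exact: subalg_cst. Qed.

Lemma subalg_scale P c x : subalg P x -> subalg P (c *: x).
Proof. by move=> Px; rewrite -(mul1r x) presAlg_scaleAl; apply/subalg_mul/Px/subalg_cst. Qed.

Lemma subalgS (P Q : A -> Prop) : (forall x, P x -> Q x) ->
  forall x, subalg P x -> subalg Q x.
Proof.
move=> PQ x; elim=> {x} [c|x /PQ Qx|x y _ Qx _ Qy|x y _ Qx _ Qy].
- exact: subalg_cst.
- exact: subalg_gen.
- exact: subalg_add.
- exact: subalg_mul.
Qed.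

Lemma subalg_comm (P : A -> Prop) y : (forall x, P x -> y * x = x * y) ->
  forall x, subalg P x -> y * x = x * y.
Proof.
move=> Py x; elim=> {x} [c|x /Py //|x z _ yx _ yz|x z _ yx _ yz].
- by rewrite -presAlg_scaleAl -presAlg_scaleAr mul1r mulr1.
- by rewrite mulrDl mulrDr yx yz.
- by rewrite mulrA yx -mulrA yz mulrA.
Qed.

Lemma lspan_mem (P : A -> Prop) x : P x -> lspan P x.
Proof. by rewrite -{2}(scale1r x); apply: lspan_scale. Qed.

Lemma lspanZ (P : A -> Prop) c x : lspan P x -> lspan P (c *: x).
Proof.
elim=> {x} [d x Px|x y _ Px _ Py]; first by rewrite scalerA; apply: lspan_scale.
by rewrite scalerDr; apply: lspan_add.
Qed.

Lemma lspan_bind (P Q : A -> Prop) (f : A -> A) :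
  (forall x y, f (x + y) = f x + f y) -> (forall c x, f (c *: x) = c *: f x) ->
  (forall x, P x -> lspan Q (f x)) -> forall x, lspan P x -> lspan Q (f x).
Proof.
move=> fD fZ PQ x; elim=> {x} [c x Px|x y _ Qx _ Qy].
  by rewrite fZ; apply/lspanZ/PQ.
by rewrite fD; apply: lspan_add.
Qed.

Lemma lspanMl (P Q : A -> Prop) a x : lspan P x ->
  (forall y, P y -> lspan Q (a * y)) -> lspan Q (a * x).
Proof.
move=> Px PQ; move: x Px.
apply: (lspan_bind (f := *%R a)) PQ => [x y|c x]; first exact: mulrDr.
by rewrite presAlg_scaleAr.
Qed.

Lemma lspanMr (P Q : A -> Prop) a x : lspan P x ->
  (forall y, P y -> lspan Q (y * a)) -> lspan Q (x * a).
Proof.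
move=> Px PQ; move: x Px.
apply: (lspan_bind (f := *%R^~ a)) PQ => [x y|c x]; first exact: mulrDl.
by rewrite presAlg_scaleAl.
Qed.

Section Tower.
Variable L : nat -> A -> Prop.

(** [L i] will be the set of generators with index i, so [tower k] plays the role of the algebra on
    k + 1 strands. Keeping it inside one algebra avoids a chain of inclusion maps. *)
Definition tower k := subalg (fun x => exists2 i, (i < k)%N & L i x).

Inductive normal_form k : A -> Prop :=
| normal_low a : tower k a -> normal_form k a
| normal_top a x b : tower k a -> L k x -> tower k b -> normal_form k (a * x * b).

Lemma towerS k x : tower k x -> tower k.+1 x.
Proof. by apply: subalgS => y [i ik Ly]; exists i => //; apply: ltnW. Qed.

Lemma tower_gen k x : L k x -> tower k.+1 x.
Proof. by move=> Lx; apply: subalg_gen; exists k. Qed.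

Variable m : nat.
Hypothesis L_far : forall i j x y, (i.+1 < j < m)%N -> L i x -> L j y -> y * x = x * y.
Hypothesis L_mul : forall j x y, (j < m)%N -> L j x -> L j y ->
  lspan (normal_form j) (x * y).
Hypothesis L_braid : forall j x y z, (j.+1 < m)%N -> L j.+1 x -> L j y -> L j.+1 z ->
  lspan (normal_form j.+1) (x * y * z).

Lemma normal_formMl k a x : tower k a -> normal_form k x -> lspan (normal_form k) (a * x).
Proof.
move=> ka [b kb|b y c kb Ly kc]; apply: lspan_mem.
  exact/normal_low/subalg_mul.
by rewrite !mulrA; apply: normal_top => //; apply: subalg_mul.
Qed.

Lemma normal_formMr k a x : tower k a -> normal_form k x -> lspan (normal_form k) (x * a).
Proof.
move=> ka [b kb|b y c kb Ly kc]; apply: lspan_mem.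
  exact/normal_low/subalg_mul.
by rewrite -!mulrA mulrA; apply: normal_top => //; apply: subalg_mul.
Qed.

Lemma lspan_nfM k a x b : tower k a -> tower k b ->
  lspan (normal_form k) x -> lspan (normal_form k) (a * x * b).
Proof.
move=> ka kb kx; apply: (lspanMr (P := normal_form k)) => [|v].
  by apply: (lspanMl kx) => v; apply: normal_formMl.
exact: normal_formMr.
Qed.

Lemma tower0 a : tower 0 a -> exists c, a = c *: (1 : A).
Proof.
elim=> {a} [c|x []//|x y _ [c ->] _ [d ->]|x y _ [c ->] _ [d ->]].
- by exists c.
- by exists (c + d); rewrite scalerDl.
- by exists (c * d); rewrite -presAlg_scaleAl mul1r scalerA.
Qed.

(* The span is shown to be stable under left multiplication by the generators;
   the hypothesis is the only case that is not immediate. *)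
Lemma tower_span_step k x :
  (forall y a z, L k y -> tower k a -> L k z -> lspan (normal_form k) (y * a * z)) ->
  tower k.+1 x -> lspan (normal_form k) x.
Proof.
move=> mid kx; rewrite -(mulr1 x).
have nf1 : lspan (normal_form k) 1 by apply/lspan_mem/normal_low/subalg1.
elim: kx (1 : A) nf1 => {x} [c|x Lx|x y _ IHx _ IHy|x y _ IHx _ IHy] w kw.
- by rewrite -presAlg_scaleAl mul1r; apply: lspanZ.
- case: Lx => i; rewrite ltnS leq_eqVlt => /orP[/eqP-> Lx|ik Lx].
    apply: (lspanMl kw) => _ [b kb|b z c kb Lz kc].
      by apply: lspan_mem; rewrite -(mul1r x); apply: normal_top => //; apply: subalg1.
    rewrite !mulrA; apply: (lspanMr (mid _ _ _ Lx kb Lz)) => v; exact: normal_formMr.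
  by apply: (lspanMl kw) => v; apply: normal_formMl; apply: subalg_gen; exists i.
- by rewrite mulrDl; apply: lspan_add; [apply: IHx|apply: IHy].
- by rewrite -mulrA; apply/IHx/IHy.
Qed.

(** By [tower_span_step] it suffices to treat y a z with y, z of height k + 1 and a below. By
    induction a is made of terms b or b w c, with w of height k and b, c of smaller height. Such b
    and c commute with y and z, so only y z and y w z remain, which are the hypotheses [L_mul] and
    [L_braid]. *)
Lemma tower_span k x : (k < m)%N -> tower k.+1 x -> lspan (normal_form k) x.
Proof.
elim: k x => [|k IHk] x km.
  suff mid y a z : L 0 y -> tower 0 a -> L 0 z -> lspan (normal_form 0) (y * a * z).
    exact: tower_span_step.
  move=> Ly /tower0[c ->] Lz.
  by rewrite -presAlg_scaleAr -presAlg_scaleAl mulr1; apply/lspanZ/L_mul.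
suff mid y a z : L k.+1 y -> tower k.+1 a -> L k.+1 z ->
    lspan (normal_form k.+1) (y * a * z) by exact: tower_span_step.
move=> Ly /(IHk _ (ltnW km)) ka Lz.
have far b : tower k b -> y * b = b * y.
  by apply: subalg_comm => u [i ik Lu]; apply: L_far Lu Ly; rewrite ltnS ik.
move: a ka; apply: (lspan_bind (f := fun w => y * w * z)) => [u v|c u|_ [a ka|a w b ka Lw kb]].
- by rewrite mulrDr mulrDl.
- by rewrite -presAlg_scaleAr -presAlg_scaleAl.
- rewrite far // -mulrA; apply: (lspanMl (L_mul km Ly Lz)) => v.
  exact/normal_formMl/towerS.
- have -> : y * (a * w * b) * z = a * (y * w * z) * b.
    have bz : b * z = z * b.
      by symmetry; move: kb; apply: subalg_comm => u [i ik Lu]; apply: L_far Lu Lz; rewrite ltnS ik.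
    by rewrite -!mulrA bz !mulrA far.
  by apply: lspan_nfM; [exact: towerS|exact: towerS|exact: L_braid].
Qed.

End Tower.

End Spans.

Lemma adjacentC m (i j : 'I_m) : adjacent i j = adjacent j i.
Proof. exact: orbC. Qed.

Lemma mulrK' (A : pzRingType) (u a b : A) : a * b = 1 -> u * a * b = u.
Proof. by move=> ab; rewrite -mulrA ab mulr1. Qed.

Lemma intertwine_inv (A : pzRingType) (x x' y y' w : A) :
  y' * y = 1 -> x * x' = 1 -> w * x = y * w -> y' * w = w * x'.
Proof.
move=> yK xK wx; rewrite -[LHS]mulr1 -xK -!mulrA (mulrA w) wx !mulrA yK mul1r.
by [].
Qed.

Lemma conj_inv (A : pzRingType) (u v x y : A) :
  v * u = 1 -> u * v = 1 -> u * x = y * u -> v * y = x * v.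
Proof.
by move=> vu uv ux; rewrite -[LHS]mulr1 -uv -mulrA (mulrA y) -ux !mulrA vu mul1r.
Qed.

(** * The BMW algebra: derived relations and reduction of top letters *)

Section BmwAlgebra.
Variables (K : fieldType) (r q : K) (n : nat).
Hypothesis z0 : q - q^-1 != 0.
Hypothesis r0 : r != 0.

Local Notation z := (q - q^-1).
Local Notation A := (bmw r q n).
Local Notation g := (@bmw_g K r q n).
Local Notation gi := (@bmw_ginv K r q n).
Local Notation e := (@bmw_e K r q n).

Lemma bmw_pcls_rel u v : @bmw_rel K r q n u v ->
  pcls (@bmw_rel K r q n) u = pcls (@bmw_rel K r q n) v.
Proof. by move=> uv; apply/pclsP/cong_rel. Qed.

Lemma pclsMC X (rel : expr K X -> expr K X -> Prop) c u :
  pcls rel (Cst c * u)%EX = c *: pcls rel u.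
Proof. by rewrite pclsM pclsC -presAlg_scaleAl mul1r. Qed.

Lemma bmw_gK i : g i * gi i = 1.
Proof. by have := bmw_pcls_rel (bmw_gV r q i); rewrite pclsM. Qed.

Lemma bmw_gVK i : gi i * g i = 1.
Proof. by have := bmw_pcls_rel (bmw_Vg r q i); rewrite pclsM. Qed.

Lemma bmw_ggg i j : adjacent i j -> g i * g j * g i = g j * g i * g j.
Proof. by move=> ij; have := bmw_pcls_rel (bmw_braid r q ij); rewrite !pclsM. Qed.

Lemma bmw_gC i j : far i j -> g i * g j = g j * g i.
Proof. by move=> ij; have := bmw_pcls_rel (bmw_comm r q ij); rewrite !pclsM. Qed.

Lemma bmw_skeinE i : g i - gi i = z *: (1 - e i).
Proof.
have := bmw_pcls_rel (bmw_skein r q i); rewrite pclsD !pclsMC pclsD pclsMC !scaleN1r.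
by rewrite pclsC scale1r.
Qed.

(** As z is invertible, e is a combination of 1, g and the inverse of g. Whatever commutes with g,
    or conjugates one g into another, therefore does the same to e. *)
Lemma bmw_eE i : e i = 1 - z^-1 *: (g i - gi i).
Proof. by rewrite bmw_skeinE scalerA mulVf // scale1r opprB addrC subrK. Qed.

Lemma bmw_ginvE i : gi i = g i - z *: (1 : A) + z *: e i.
Proof. by rewrite addrAC -addrA -scalerBr -(opprB (1 : A)) scalerN -bmw_skeinE opprB addrC subrK. Qed.

Lemma bmw_eg_r i : e i * g i = r^-1 *: e i.
Proof. by have := bmw_pcls_rel (bmw_eg r q i); rewrite pclsMC pclsM. Qed.

Lemma bmw_comm_e i x : x * g i = g i * x -> x * gi i = gi i * x /\ x * e i = e i * x.
Proof.
move=> xg.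
have xgi : x * gi i = gi i * x.
  by rewrite -[LHS]mul1r -(bmw_gVK i) -!mulrA (mulrA _ x) -xg -!mulrA bmw_gK mulr1.
split=> //; rewrite bmw_eE mulrBl mulrBr mulr1 mul1r -presAlg_scaleAr -presAlg_scaleAl.
by rewrite mulrBl mulrBr xg xgi.
Qed.

Lemma bmw_ge_r i : g i * e i = r^-1 *: e i.
Proof. by rewrite -bmw_eg_r; apply: (bmw_comm_e _).2. Qed.

Lemma bmw_egi i : e i * gi i = r *: e i.
Proof.
have /(congr1 (fun x => r *: (x * gi i))) := bmw_eg_r i.
by rewrite -mulrA bmw_gK mulr1 -presAlg_scaleAl scalerA mulfV // scale1r => <-.
Qed.

Lemma bmw_gie i : gi i * e i = r *: e i.
Proof.
have /(congr1 (fun x => r *: (gi i * x))) := bmw_ge_r i.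
by rewrite mulrA bmw_gVK mul1r -presAlg_scaleAr scalerA mulfV // scale1r => <-.
Qed.

(** The scalar is the loop value 1 + (r - r^-1) / z of the Kauffman skein theory. *)
Lemma bmw_ee i : e i * e i = (1 - z^-1 * (r^-1 - r)) *: e i.
Proof.
rewrite {2}bmw_eE mulrBr mulr1 -presAlg_scaleAr mulrBr bmw_eg_r bmw_egi.
by rewrite -scalerBl scalerA scalerBl scale1r.
Qed.

Lemma bmw_gg i : g i * g i = 1 + z *: g i - (z * r^-1) *: e i.
Proof.
have -> : g i * g i = g i * (gi i + z *: (1 - e i)) by rewrite -bmw_skeinE addrC subrK.
rewrite mulrDr bmw_gK -presAlg_scaleAr mulrBr mulr1 bmw_ge_r scalerBr scalerA.
by rewrite addrA.
Qed.

Section Adjacent.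
Variables i j : 'I_n.-1.
Hypothesis ij : adjacent i j.

Lemma bmw_ege_r : e i * g j * e i = r *: e i.
Proof. by have := bmw_pcls_rel (bmw_ege r q ij); rewrite pclsMC !pclsM. Qed.

Lemma bmw_egie_r : e i * gi j * e i = r^-1 *: e i.
Proof. by have := bmw_pcls_rel (bmw_eVe r q ij); rewrite pclsMC !pclsM. Qed.

(** The braid relation says that g_i g_j conjugates g_i into g_j; it then conjugates the inverses,
    and by [bmw_eE] also e_i into e_j. *)
Lemma bmw_gge : g i * g j * e i = e j * g i * g j.
Proof.
rewrite !bmw_eE mulrBr !mulrBl mulr1 mul1r -presAlg_scaleAr -!presAlg_scaleAl.
rewrite mulrBr !mulrBl (bmw_ggg ij); congr (_ - _ *: (_ - _)).
apply: esym; rewrite -mulrA; apply: intertwine_inv (bmw_gVK j) (bmw_gK i) _.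
by rewrite bmw_ggg // mulrA.
Qed.

End Adjacent.

Lemma bmw_gigie i j : adjacent i j -> gi i * gi j * e i = e j * gi i * gi j.
Proof.
rewrite adjacentC => ij; rewrite -[RHS]mulrA.
have uv : (g j * g i) * (gi i * gi j) = 1 by rewrite -mulrA (mulrA (g i)) bmw_gK mul1r bmw_gK.
have vu : (gi i * gi j) * (g j * g i) = 1 by rewrite -mulrA (mulrA (gi j)) bmw_gVK mul1r bmw_gVK.
by apply: (conj_inv vu uv); rewrite bmw_gge // mulrA.
Qed.

Section AdjacentEE.
Variables i j : 'I_n.-1.
Hypothesis ij : adjacent i j.
Let ji : adjacent j i. Proof. by rewrite adjacentC. Qed.

(** After multiplication by g_j, [bmw_gge] turns e_j g_i g_j into g_i g_j e_i, and the relations for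
    e_i g_i and e_i g_j e_i finish. This and the next relations, up to [bmw_eee], trade two letters
    of index i around one of index j for at most one letter of index i. *)
Lemma bmw_eeg : e i * e j * g i = e i * gi j.
Proof.
rewrite -[LHS]mulr1 -(bmw_gK j) mulrA; congr (_ * _).
rewrite -!mulrA (mulrA (e j)) -bmw_gge // !mulrA bmw_eg_r -!presAlg_scaleAl.
by rewrite bmw_ege_r // scalerA mulVf // scale1r.
Qed.

Lemma bmw_gee : g i * e j * e i = gi j * e i.
Proof.
rewrite -[LHS]mul1r -(bmw_gVK j) -[LHS]mulrA; congr (_ * _).
rewrite !mulrA bmw_gge // -!mulrA bmw_ge_r -!presAlg_scaleAr.
by rewrite mulrA bmw_ege_r // scalerA mulVf // scale1r.
Qed.

Lemma bmw_egg : e i * g j * g i = e i * e j.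
Proof.
have: e i * e j * gi i * gi j = e i.
  rewrite -!mulrA (mulrA (e j)) -bmw_gigie // !mulrA bmw_egi -!presAlg_scaleAl.
  by rewrite bmw_egie_r // scalerA mulfV // scale1r.
by move=> {1}<-; rewrite !(mulrK' _ (bmw_gVK _)).
Qed.

Lemma bmw_gge_ee : g i * g j * e i = e j * e i.
Proof.
have: gi j * (gi i * (e j * e i)) = e i.
  rewrite !mulrA bmw_gigie // -!mulrA bmw_gie -!presAlg_scaleAr.
  by rewrite mulrA bmw_egie_r // scalerA mulfV // scale1r.
by move=> {1}<-; rewrite -mulrA (mulrA (g j)) bmw_gK mul1r mulrA bmw_gK mul1r.
Qed.

Lemma bmw_gieg : gi i * e j * g i = g j * e i * gi j.
Proof.
have := congr1 (fun x => gi i * x * gi j) (bmw_gge ij).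
by rewrite !mulrA bmw_gVK mul1r (mulrK' _ (bmw_gK j)) => ->.
Qed.

(** Conjugation only reaches the product whose first factor is the inverse of g_i, see [bmw_gieg].
    The skein relation replaces g_i by that inverse at the price of the two extra terms. *)
Lemma bmw_geg : g i * e j * g i = g j * e i * gi j + z *: (e j * g i) - z *: (e i * gi j).
Proof.
have gE : g i = gi i + z *: (1 - e i) by rewrite -bmw_skeinE addrC subrK.
rewrite {1}gE !mulrDl bmw_gieg -!presAlg_scaleAl mulrBl mul1r mulrBl bmw_eeg.
by rewrite scalerBr addrA.
Qed.

(** The two corrections cancel and the scalar is 1; it is left as it comes, since the reduction only
    needs a multiple of e_i. *)
Lemma bmw_eee : e i * e j * e i = (1 - z^-1 * (r^-1 - r) - z^-1 * (r - r^-1)) *: e i.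
Proof.
rewrite {1}(bmw_eE j) mulrBr mulr1 mulrBl bmw_ee -presAlg_scaleAr -presAlg_scaleAl.
by rewrite (mulrBr (e i)) (mulrBl (e i)) bmw_ege_r // bmw_egie_r // -scalerBl scalerA -scalerBl.
Qed.
End AdjacentEE.

(** The inverse of g is not a letter: by [bmw_ginvE] it is a combination of 1, g and e with the same
    index. *)
Inductive bmw_level (k : nat) : A -> Prop :=
| bmw_level_g (i : 'I_n.-1) : i = k :> nat -> bmw_level k (g i)
| bmw_level_e (i : 'I_n.-1) : i = k :> nat -> bmw_level k (e i).

Lemma bmw_level_far k l x y : (k.+1 < l)%N -> bmw_level k x -> bmw_level l y -> y * x = x * y.
Proof.
move=> kl kx ly.
have xg (j : 'I_n.-1) : j = l :> nat -> x * g j = g j * x.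
  move=> jl; case: kx => i ik.
    by apply: bmw_gC; rewrite /far jl ik kl.
  by symmetry; apply: (bmw_comm_e _).2; apply: bmw_gC; rewrite /far jl ik kl orbT.
by case: ly => j /xg // /bmw_comm_e[].
Qed.

Lemma bmw_ginv_tower (i : 'I_n.-1) : tower bmw_level i.+1 (gi i).
Proof.
rewrite bmw_ginvE; apply: subalg_add; [apply: subalg_add|].
- exact/tower_gen/bmw_level_g.
- by rewrite -scaleNr; apply: subalg_cst.
- by apply/subalg_scale/tower_gen/bmw_level_e.
Qed.

Lemma bmw_level_mul k x y : bmw_level k x -> bmw_level k y ->
  lspan (normal_form bmw_level k) (x * y).
Proof.
have one : lspan (normal_form bmw_level k) 1.
  exact/lspan_mem/normal_low/subalg1.
have top u : bmw_level k u -> lspan (normal_form bmw_level k) u.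
  move=> ku; apply: lspan_mem; rewrite -[u]mul1r -[_ * u]mulr1.
  by apply: normal_top => //; exact: subalg1.
have tope (i : 'I_n.-1) : i = k :> nat -> lspan (normal_form bmw_level k) (e i).
  by move=> ?; apply/top/bmw_level_e.
case=> i ik; case=> j jk; (have -> : j = i by apply: val_inj; rewrite /= ik jk).
- rewrite bmw_gg -scaleNr; apply: lspan_add; last exact/lspanZ/tope.
  by apply: lspan_add => //; apply/lspanZ/top/bmw_level_g.
- by rewrite bmw_ge_r; apply/lspanZ/tope.
- by rewrite bmw_eg_r; apply/lspanZ/tope.
- by rewrite bmw_ee; apply/lspanZ/tope.
Qed.

(** Each of the eight choices of g or e for the three letters is settled by one of the relations for
    adjacent indices. *)
Lemma bmw_level_braid k x y w : bmw_level k.+1 x -> bmw_level k y -> bmw_level k.+1 w ->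
  lspan (normal_form bmw_level k.+1) (x * y * w).
Proof.
have ntop a u b : tower bmw_level k.+1 a -> bmw_level k.+1 u -> tower bmw_level k.+1 b ->
    lspan (normal_form bmw_level k.+1) (a * u * b).
  by move=> *; apply/lspan_mem/normal_top.
have nl a u : tower bmw_level k.+1 a -> bmw_level k.+1 u ->
    lspan (normal_form bmw_level k.+1) (a * u).
  by move=> ka ku; rewrite -[_ * u]mulr1; apply: ntop => //; exact: subalg1.
have nr u b : bmw_level k.+1 u -> tower bmw_level k.+1 b ->
    lspan (normal_form bmw_level k.+1) (u * b).
  by move=> ku kb; rewrite -[u]mul1r; apply: ntop => //; exact: subalg1.
have n1 u : bmw_level k.+1 u -> lspan (normal_form bmw_level k.+1) u.
  by move=> ku; rewrite -[u]mul1r; apply: nl => //; exact: subalg1.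
case=> i ik; case=> j jk; case=> l lk; (have -> : l = i by apply: val_inj; rewrite /= ik lk);
  (have ij : adjacent i j by rewrite /adjacent ik jk eqxx orbT);
  have ug := bmw_level_g ik; have ue := bmw_level_e ik;
  have vg := tower_gen (bmw_level_g jk); have ve := tower_gen (bmw_level_e jk);
  (have vi : tower bmw_level k.+1 (gi j) by rewrite -jk; exact: bmw_ginv_tower).
- by rewrite bmw_ggg //; exact: ntop.
- by rewrite bmw_gge_ee //; exact: nl.
- rewrite bmw_geg // -scaleNr; apply: lspan_add; last exact/lspanZ/nr.
  by apply: lspan_add; [exact: ntop|exact/lspanZ/nl].
- by rewrite bmw_gee //; exact: nl.
- by rewrite bmw_egg //; exact: nr.
- by rewrite bmw_ege_r //; exact/lspanZ/n1.
- by rewrite bmw_eeg //; exact: nr.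
- by rewrite bmw_eee //; exact/lspanZ/n1.
Qed.

Lemma bmw_tower (a : A) : tower bmw_level n.-1 a.
Proof.
elim/presAlg_ind: a => [c|[]i|a b|a b].
- exact: subalg_cst.
- by apply: subalg_gen; exists i; [exact: ltn_ord|exact: bmw_level_g].
- apply: subalgS (bmw_ginv_tower i) => x [k ki kx]; exists k => //.
  exact: leq_trans ki _.
- by apply: subalg_gen; exists i; [exact: ltn_ord|exact: bmw_level_e].
- exact: subalg_add.
- exact: subalg_mul.
Qed.

End BmwAlgebra.

Section BmwNormalForm.
Variables (K : fieldType) (r q : K) (n : nat).
Hypothesis z0 : q - q^-1 != 0.
Hypothesis r0 : r != 0.
Local Notation incl := (@bmw_incl K r q n.+1).

Lemma bmw_tower_incl (a : bmw r q n.+2) :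
  tower (@bmw_level K r q n.+2) n a -> exists b, a = incl b.
Proof.
have w := @bmw_widen_rel K r q n.+1.
elim=> {a} [c|x [k kn []i ik]|x y _ [a ->] _ [b ->]|x y _ [a ->] _ [b ->]].
- by exists (c *: (1 : bmw r q n.+1)); rewrite /bmw_incl phomZ // phom1.
- have ikn : (i < n)%N by rewrite ik.
  exists (bmw_g r q (Ordinal ikn : 'I_n.+1.-1)); rewrite /bmw_incl phom_gen //=.
  by congr (pgen _ (BmwG _)); apply: val_inj.
- have ikn : (i < n)%N by rewrite ik.
  exists (bmw_e r q (Ordinal ikn : 'I_n.+1.-1)); rewrite /bmw_incl phom_gen //=.
  by congr (pgen _ (BmwE _)); apply: val_inj.
- by exists (a + b); rewrite /bmw_incl phomD.
- by exists (a * b); rewrite /bmw_incl phomM.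
Qed.

(** The three shapes are those on which a Markov trace can be evaluated: in the last two, cyclicity
    brings b in front of a, and the Markov property removes the top letter. *)
Lemma bmw_normal_ind (P : bmw r q n.+2 -> Prop) :
  (forall c a, P a -> P (c *: a)) -> (forall a b, P a -> P b -> P (a + b)) ->
  (forall a, P (incl a)) ->
  (forall a b, P (incl a * @bmw_g _ r q n.+2 ord_max * incl b)) ->
  (forall a b, P (incl a * @bmw_e _ r q n.+2 ord_max * incl b)) ->
  forall a, P a.
Proof.
move=> PZ PD Pi Pg Pe a.
have: lspan (normal_form (@bmw_level K r q n.+2) n) a.
  (* On n + 2 strands there are n + 1 generators, of heights 0 to n. *)
  apply: (@tower_span _ _ _ _ n.+1) => //.
  - by move=> i j x y /andP[ij _]; exact: bmw_level_far.
  - by move=> j x y _; exact: bmw_level_mul.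
  - by move=> j x y w _; exact: bmw_level_braid.
  - exact: bmw_tower.
have max (i : 'I_n.+2.-1) : i = n :> nat -> i = ord_max.
  by move=> ?; apply: val_inj.
elim=> {a} [c _ [a|a x b]|a b _ Pa _ Pb]; last exact: PD.
- by move=> /bmw_tower_incl[b ->]; apply: PZ.
- by move=> /bmw_tower_incl[{}a ->] [] i /max -> /bmw_tower_incl[{}b ->]; exact: PZ.
Qed.

End BmwNormalForm.

(** * The Temperley-Lieb algebra: the same reduction *)

Section TlAlgebra.
Variables (K : fieldType) (q : K) (n : nat).

Local Notation A := (tl q n).
Local Notation p := (@tl_p K q n).

Lemma tl_pcls_rel u v : @tl_rel K q n u v -> pcls (@tl_rel K q n) u = pcls (@tl_rel K q n) v.
Proof. by move=> uv; apply/pclsP/cong_rel. Qed.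

Lemma tl_ppp i j : adjacent i j -> p i * p j * p i = (q + q^-1) ^- 2 *: p i.
Proof. by move=> ij; have := tl_pcls_rel (tl_pjp q ij); rewrite pclsMC !pclsM. Qed.

Lemma tl_pC i j : far i j -> p i * p j = p j * p i.
Proof. by move=> ij; have := tl_pcls_rel (tl_comm q ij); rewrite !pclsM. Qed.

Inductive tl_level (k : nat) : A -> Prop :=
| tl_level_p (i : 'I_n.-1) : i = k :> nat -> tl_level k (p i).

Lemma tl_level_far k l x y : (k.+1 < l)%N -> tl_level k x -> tl_level l y -> y * x = x * y.
Proof. by move=> kl [] i ik [] j jl; apply: tl_pC; rewrite /far ik jl kl orbT. Qed.

Lemma tl_level_nf k x : tl_level k x -> normal_form tl_level k x.
Proof.
move=> kx; rewrite -[x]mul1r -[_ * x]mulr1.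
by apply: normal_top => //; exact: subalg1.
Qed.

Lemma tl_level_mul k x y : tl_level k x -> tl_level k y ->
  lspan (normal_form tl_level k) (x * y).
Proof.
move=> [] i ik [] j jk; have -> : j = i by apply: val_inj; rewrite /= ik jk.
by rewrite tl_pp; apply/lspan_mem/tl_level_nf.
Qed.

Lemma tl_level_braid k x y w : tl_level k.+1 x -> tl_level k y -> tl_level k.+1 w ->
  lspan (normal_form tl_level k.+1) (x * y * w).
Proof.
move=> [] i ik [] j jk [] l lk; have -> : l = i by apply: val_inj; rewrite /= ik lk.
rewrite tl_ppp; last by rewrite /adjacent ik jk eqxx orbT.
by apply/lspanZ/lspan_mem/tl_level_nf.
Qed.

Lemma tl_tower (a : A) : tower tl_level n.-1 a.
Proof.
elim/presAlg_ind: a => [c|i|a b|a b].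
- exact: subalg_cst.
- by apply: subalg_gen; exists i; [exact: ltn_ord|exact: tl_level_p].
- exact: subalg_add.
- exact: subalg_mul.
Qed.

End TlAlgebra.

Section TlNormalForm.
Variables (K : fieldType) (q : K) (n : nat).
Local Notation incl := (@tl_incl K q n.+1).

Lemma tl_tower_incl (a : tl q n.+2) :
  tower (@tl_level K q n.+2) n a -> exists b, a = incl b.
Proof.
have w := @tl_widen_rel K q n.+1.
elim=> {a} [c|x [k kn []i ik]|x y _ [a ->] _ [b ->]|x y _ [a ->] _ [b ->]].
- by exists (c *: (1 : tl q n.+1)); rewrite /tl_incl phomZ // phom1.
- have ikn : (i < n)%N by rewrite ik.
  exists (tl_p q (Ordinal ikn : 'I_n.+1.-1)); rewrite /tl_incl phom_gen //=.
  by congr (pgen _ _); apply: val_inj.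
- by exists (a + b); rewrite /tl_incl phomD.
- by exists (a * b); rewrite /tl_incl phomM.
Qed.

Lemma tl_normal_ind (P : tl q n.+2 -> Prop) :
  (forall c a, P a -> P (c *: a)) -> (forall a b, P a -> P b -> P (a + b)) ->
  (forall a, P (incl a)) ->
  (forall a b, P (incl a * @tl_p _ q n.+2 ord_max * incl b)) ->
  forall a, P a.
Proof.
move=> PZ PD Pi Pp a.
have: lspan (normal_form (@tl_level K q n.+2) n) a.
  apply: (@tower_span _ _ _ _ n.+1) => //.
  - by move=> i j x y /andP[ij _]; exact: tl_level_far.
  - by move=> j x y _; exact: tl_level_mul.
  - by move=> j x y w _; exact: tl_level_braid.
  - exact: tl_tower.
have max (i : 'I_n.+2.-1) : i = n :> nat -> i = ord_max.
  by move=> ?; apply: val_inj.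
elim=> {a} [c _ [a|a x b]|a b _ Pa _ Pb]; last exact: PD.
- by move=> /tl_tower_incl[b ->]; apply: PZ.
- by move=> /tl_tower_incl[{}a ->] [] i /max -> /tl_tower_incl[{}b ->]; exact: PZ.
Qed.

End TlNormalForm.

Lemma presAlg_scalar (K : comPzRingType) X (rel : expr K X -> expr K X -> Prop) :
  (X -> False) -> forall a : presAlg rel, exists c, a = c *: (1 : presAlg rel).
Proof.
move=> X0; elim/presAlg_ind => [c|x|_ _ [c ->] [d ->]|_ _ [c ->] [d ->]].
- by exists c.
- by case: (X0 x).
- by exists (c + d); rewrite scalerDl.
- by exists (c * d); rewrite -presAlg_scaleAl mul1r scalerA.
Qed.

(** * Compatibility of Markov traces with the inclusions *)

Section Traces.
Variables (K : fieldType) (q : K).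
Hypothesis s0 : q + q^-1 != 0.

(* The Markov property of [p_(n+1)] and [p_n] on a common element of the smaller
   algebra, connected by [p_(n+1) p_n p_(n+1) = (q + 1/q)^-2 p_(n+1)]. *)
Lemma tl_trace_incl (tr : forall n, {scalar tl q n}) : tl_markov_trace tr ->
  forall n (a : tl q n.+1), tr n.+2 (tl_incl a) = tr n.+1 a.
Proof.
move=> [_ trC trp] n a.
have w m := @tl_widen_rel K q m.
have t0 : (q + q^-1) ^- 2 != 0 by rewrite invr_eq0 expf_neq0.
have incM m (x y : tl q m) : tl_incl (x * y) = tl_incl x * tl_incl y.
  exact: (phomM (@w m)).
set i : 'I_n.+3.-1 := ord_max; pose j : 'I_n.+3.-1 := widen_ord (leqnSn _) (ord_max : 'I_n.+1).
have pE : tl_incl (@tl_p _ q n.+2 ord_max) = tl_p q j.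
  by rewrite /tl_incl (phom_gen (@w _)); congr (pgen _ _); apply: val_inj.
have ij : adjacent i j by rewrite /adjacent /= eqxx orbT.
have far x : tl_incl (tl_incl x) * tl_p q i = tl_p q i * tl_incl (tl_incl x : tl q n.+2).
  rewrite /tl_incl; elim/presAlg_ind: x => [c|k|x y xi yi|x y xi yi].
  - by rewrite !(phomZ (@w _)) !(phom1 (@w _)) -presAlg_scaleAl -presAlg_scaleAr mul1r mulr1.
  - rewrite !(phom_gen (@w _)); apply: tl_pC; rewrite /far /= -[ltnRHS]/(n.+1).
    by rewrite !ltnS ltn_ord.
  - by rewrite !(phomD (@w _)) mulrDl mulrDr xi yi.
  - by rewrite !(phomM (@w _)) -mulrA yi mulrA xi mulrA.
apply: (mulfI t0); apply: (mulfI t0).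
rewrite -[in RHS]trp -[RHS]trp -[in LHS]trp -[LHS]linearZ incM pE /=.
rewrite presAlg_scaleAr -(tl_ppp _ ij) !mulrA far -!mulrA trC !mulrA.
by rewrite -(mulrA _ (tl_p q i)) tl_pp.
Qed.

(** The skein relation solved for 1 writes the unit through e, g and the inverse of g of the last
    index. The Markov values then sum to a third of the loop value, which is 1 when the loop value
    is 3. *)
Lemma bmw_trace_incl (r : K) (tr : forall n, {scalar bmw r q n}) :
  q - q^-1 != 0 -> 1 + (r - r^-1) / (q - q^-1) = 3%:R -> 3%:R != 0 :> K ->
  bmw_markov_trace tr ->
  forall n (a : bmw r q n.+1), tr n.+2 (bmw_incl a) = tr n.+1 a.
Proof.
move=> z0 x3 n3 [_ _ trg trgi tre] n a.
have -> : bmw_incl a = bmw_incl a * @bmw_e _ r q n.+2 ord_max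
   + (q - q^-1)^-1 *: (bmw_incl a * @bmw_g _ r q n.+2 ord_max -
      bmw_incl a * @bmw_ginv _ r q n.+2 ord_max).
  rewrite -mulrBr bmw_skeinE // -presAlg_scaleAr scalerA mulVf // scale1r.
  by rewrite mulrBr mulr1 addrC subrK.
rewrite linearD linearZ linearB /= tre trg trgi -mulrBl mulrA -mulrDl.
rewrite -[RHS]mul1r; congr (_ * _); apply: (mulfI n3).
rewrite mulrDr mulfV // mulr1 -[in RHS]x3.
move: (q - q^-1) r^-1 z0 => z ri z0.
by field; rewrite z0 n3.
Qed.
End Traces.

(** * Shift and phase operators on the tensor power *)

Section Average.
Variables (K : fieldType) (N : nat).
Hypothesis n3 : 3%:R != 0 :> K.
Implicit Types a b x y : 'M[K]_N.

(** For a of order 3 this is the projection onto the vectors fixed by a. *)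
Definition avg a : 'M[K]_N := 3%:R^-1 *: (1 + a + a * a).

Lemma avg_comm a x : x * a = a * x -> x * avg a = avg a * x.
Proof.
move=> xa; rewrite /avg -mx_scalerAr -mx_scalerAl !mulrDr !mulrDl mulr1 mul1r.
by rewrite xa mulrA xa -!mulrA xa.
Qed.

Lemma mul_avg a : a * a * a = 1 -> a * avg a = avg a.
Proof.
move=> a3; rewrite /avg -mx_scalerAr !mulrDr mulr1 mulrA a3.
by rewrite addrC addrA.
Qed.

Lemma avg_mul a : a * a * a = 1 -> avg a * a = avg a.
Proof. by move=> a3; rewrite -avg_comm // mul_avg. Qed.

Lemma avg_sum a u : a * u = u -> avg a * u = u.
Proof.
move=> au; rewrite /avg -mx_scalerAl !mulrDl mul1r -mulrA au au.
have -> : u + u + u = 3%:R *: u by rewrite scaler_nat mulrSr mulr2n.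
by rewrite scalerA mulVf // scale1r.
Qed.

Lemma avg_idem a : a * a * a = 1 -> avg a * avg a = avg a.
Proof. by move/mul_avg/avg_sum. Qed.

(** A factor a taken out of the left average passes b at the cost of zeta and is absorbed by the
    right average, so the product equals zeta times itself. *)
Lemma avg_twist0 a b zeta : a * a * a = 1 -> zeta != 1 -> a * b = zeta *: (b * a) ->
  avg a * b * avg a = 0.
Proof.
move=> a3 z1 ab; have : avg a * b * avg a = zeta *: (avg a * b * avg a).
  by rewrite -{1}(avg_mul a3) -(mulrA _ a) ab -(mx_scalerAr zeta) -(mx_scalerAl zeta) -!mulrA mul_avg.
move/eqP; rewrite -subr_eq0 -{1}[_ * avg a]scale1r -scalerBl scaler_eq0 subr_eq0.
by rewrite eq_sym (negPf z1) => /eqP.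
Qed.

(** In the expansion of the middle average, b and its square are twisted by zeta and zeta^2 and
    vanish by [avg_twist0]. Only the unit term survives, with coefficient 1/3. *)
Lemma avg_braid a b zeta : a * a * a = 1 -> zeta != 1 -> zeta ^+ 2 != 1 ->
  a * b = zeta *: (b * a) -> avg a * avg b * avg a = 3%:R^-1 *: avg a.
Proof.
move=> a3 z1 z2 ab.
have abb : a * (b * b) = zeta ^+ 2 *: (b * b * a).
  by rewrite mulrA ab -(mx_scalerAl zeta) -(mulrA b a) ab -(mx_scalerAr zeta) scalerA mulrA -expr2.
rewrite {2}/avg -(mx_scalerAr 3%:R^-1 (avg a)) -(mx_scalerAl 3%:R^-1) !mulrDr !mulrDl mulr1 avg_idem //.
by rewrite (avg_twist0 a3 z1 ab) (avg_twist0 a3 z2 abb) !addr0.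
Qed.

(* Conjugation by [y] preserves the trace and multiplies it by [zeta]. *)
Lemma mxtrace_twist0 x y y' a zeta : y' * y = 1 -> y * y' = 1 -> zeta != 1 ->
  x * y = y * x -> y * a = zeta *: (a * y) -> \tr (x * a) = 0.
Proof.
move=> y'K yK z1 xy ya; have tr0 : \tr (x * a) = zeta * \tr (x * a).
  have yxa : \tr (y * (x * a) * y') = \tr (x * a).
    by rewrite [LHS]mxtrace_mulC; congr mxtrace; rewrite [LHS](mulrA y') y'K mul1r.
  rewrite -[LHS]yxa -mxtraceZ mulrA -xy -(mulrA x y a) ya; congr mxtrace.
  by rewrite -(mx_scalerAr zeta) -(mx_scalerAl zeta) -(mulrA x) -(mulrA a) yK mulr1.
by apply/eqP; move/eqP: tr0; rewrite -subr_eq0 -{1}[\tr _]mul1r -mulrBl mulf_eq0 subr_eq0 eq_sym (negPf z1).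
Qed.

(** As in [avg_braid], only the unit term of the average contributes. *)
Lemma mxtrace_avg x y y' a zeta : y' * y = 1 -> y * y' = 1 ->
  zeta != 1 -> zeta ^+ 2 != 1 -> x * y = y * x -> y * a = zeta *: (a * y) ->
  \tr (x * avg a) = 3%:R^-1 * \tr x.
Proof.
move=> y'K yK z1 z2 xy ya.
have yaa : y * (a * a) = zeta ^+ 2 *: (a * a * y).
  by rewrite mulrA ya -(mx_scalerAl zeta) -(mulrA a y) ya -(mx_scalerAr zeta) scalerA mulrA -expr2.
rewrite /avg -mx_scalerAr mxtraceZ !mulrDr mulr1 !raddfD /=.
by rewrite (mxtrace_twist0 y'K yK z1 xy ya) (mxtrace_twist0 y'K yK z2 xy yaa) !addr0.
Qed.
End Average.

(** * Weyl operators over F_3 *)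

Section Weyl.
Variables (K : fieldType) (w : K) (m : nat).
Hypothesis w3 : w ^+ 3 = 1.

Local Notation V := {ffun 'I_m -> 'F_3}.
Implicit Types u v f h : V.

Definition chi (x : 'F_3) : K := w ^+ x.

Lemma chiD x y : chi (x + y) = chi x * chi y.
Proof. by rewrite /chi -exprD; apply: expr_mod. Qed.

Lemma chi0 : chi 0 = 1. Proof. exact: expr0. Qed.

Definition dot f v : 'F_3 := \sum_k f k * v k.

Lemma dotDl f h v : dot (f + h) v = dot f v + dot h v.
Proof. by rewrite -big_split; apply: eq_bigr => k _; rewrite ffunE mulrDl. Qed.

Lemma dotDr f u v : dot f (u + v) = dot f u + dot f v.
Proof. by rewrite -big_split; apply: eq_bigr => k _; rewrite ffunE mulrDr. Qed.

Lemma dotNr f v : dot f (- v) = - dot f v.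
Proof. by rewrite -sumrN; apply: eq_bigr => k _; rewrite ffunE mulrN. Qed.

Lemma dot0l v : dot 0 v = 0.
Proof. by apply: big1 => k _; rewrite ffunE mul0r. Qed.

Lemma dot0r f : dot f 0 = 0.
Proof. by apply: big1 => k _; rewrite ffunE mulr0. Qed.

(* [weyl v f] sends the basis vector e_x to w^(f . x) e_(x + v). *)
Definition weyl v f : 'M[K]_#|V| :=
  \matrix_(a, b) if (enum_val a : V) == (enum_val b : V) + v then chi (dot f (enum_val b)) else 0.

Lemma weylM v f v' f' :
  weyl v f * weyl v' f' = chi (dot f v') *: weyl (v' + v) (f + f').
Proof.
apply/matrixP => a c; rewrite !mxE (bigD1 (enum_rank ((enum_val c : V) + v'))) //=.
rewrite !mxE enum_rankK eqxx big1 ?addr0 => [|b /eqP bc].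
  rewrite addrA; case: eqP => _; last by rewrite mul0r mulr0.
  by rewrite -chiD -chiD dotDr dotDl addrA (addrC (dot f v')).
rewrite !mxE; case: (enum_val b =P _) => [bE|]; last by rewrite mulr0.
by case: bc; rewrite -bE enum_valK.
Qed.

Lemma weyl1 : weyl 0 0 = 1.
Proof.
apply/matrixP => a b; rewrite !mxE addr0 (inj_eq enum_val_inj) dot0l chi0.
by case: eqP.
Qed.

(** The exponent is the symplectic form of the pairs (v, f) and (v', f'). *)
Lemma weylC v f v' f' :
  weyl v f * weyl v' f' = chi (dot f v' - dot f' v) *: (weyl v' f' * weyl v f).
Proof. by rewrite !weylM scalerA -chiD subrK addrC (addrC f). Qed.

Lemma F3_triple u : u + u + u = 0.
Proof.
apply/ffunP => k; rewrite !ffunE; move: (u k) => x; apply/val_inj.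
by case: x => [[|[|[|]]]].
Qed.

(** Indexed by naturals so that i + 1 needs no cast. Out of range it is the zero vector, which is
    why later statements bound their indices by m. *)
Definition unitv (i : nat) : V := [ffun k : 'I_m => (k == i :> nat)%:R].

Lemma dot_unitv f (i : 'I_m) : dot f (unitv i) = f i.
Proof.
rewrite /dot (bigD1 i) //= ffunE eqxx mulr1 big1 ?addr0 // => k ki.
by rewrite ffunE (inj_eq (@ord_inj _)) (negPf ki) mulr0.
Qed.

Definition shiftv (i : nat) : V := unitv i - unitv i.+1.
Definition sumv (i : nat) : V := unitv i + unitv i.+1.

Lemma dot_unitv2 i j : (i < m)%N -> dot (unitv j) (unitv i) = (i == j)%:R.
Proof. by move=> im; rewrite (dot_unitv _ (Ordinal im)) ffunE. Qed.

(** For i = j the contributions of the two strands cancel; only a neighbouring pair shares exactly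
    one strand and leaves a nonzero value. *)
Lemma dot_sumv_shiftv i j : (i.+1 < m)%N -> (j.+1 < m)%N ->
  dot (sumv i) (shiftv j) = (j == i.+1)%:R - (i == j.+1)%:R.
Proof.
move=> im jm; rewrite dotDl !dotDr !dotNr !dot_unitv2 ?(ltnW jm) //.
rewrite eqSS (eq_sym j.+1); case: (j == i); case: (i == j.+1); case: (j == i.+1) => //=; apply/val_inj => //=.
Qed.

(* The factor [w] is the phase for which the Gaussian sums in R_3 take the same
   coefficient on an operator and on its inverse. *)
Definition opD i := w *: weyl (shiftv i) 0.
Definition opW i := w *: weyl 0 (sumv i).

End Weyl.

Lemma mx_scalerM (K : comPzRingType) N c d (a b : 'M[K]_N) :
  (c *: a) * (d *: b) = (c * d) *: (a * b).
Proof. by rewrite -mx_scalerAl -mx_scalerAr scalerA. Qed.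

(** * The two commuting Temperley-Lieb families and their traces *)

Section Potts.
Variables (K : fieldType) (w : K) (m : nat).
Hypothesis w3 : w ^+ 3 = 1.
Hypothesis w1 : w != 1.
Hypothesis n3 : 3%:R != 0 :> K.

Local Notation V := {ffun 'I_m -> 'F_3}.
Local Notation chi := (chi w).
Local Notation weyl := (@weyl K w m).
Local Notation opD := (@opD K w m).
Local Notation opW := (@opW K w m).

Lemma root_sqr_neq1 : w ^+ 2 != 1.
Proof. by apply: contraNneq w1 => w2; rewrite -[w]mul1r -{1}w2 -exprSr w3. Qed.

Lemma chi_neq1 x : x != 0 -> chi x != 1 /\ chi x ^+ 2 != 1.
Proof.
case: x => [[|[|[|]]]] //= i _; rewrite /chi /= ?expr1; split=> //.
- exact: root_sqr_neq1.
- exact: root_sqr_neq1.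
- by rewrite -exprM (exprD w 3 1) w3 mul1r expr1.
Qed.

Lemma weyl_vM v v' : weyl v 0 * weyl v' 0 = weyl (v' + v) 0.
Proof. by rewrite weylM // dot0l chi0 scale1r addr0. Qed.

Lemma weyl_fM f f' : weyl 0 f * weyl 0 f' = weyl 0 (f + f').
Proof. by rewrite weylM // dot0r chi0 scale1r addr0. Qed.

Lemma scaled_cube (x : 'M[K]_#|V|) : (w *: x) * (w *: x) * (w *: x) = x * x * x.
Proof.
by rewrite !mx_scalerM -expr2 -exprSr w3 scale1r.
Qed.

Lemma opD3 i : opD i * opD i * opD i = 1.
Proof. by rewrite scaled_cube !weyl_vM addrA F3_triple weyl1. Qed.

Lemma opW3 i : opW i * opW i * opW i = 1.
Proof. by rewrite scaled_cube !weyl_fM F3_triple weyl1. Qed.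

Lemma opDD i j : opD i * opD j = opD j * opD i.
Proof.
rewrite /opD -!mx_scalerAl -!mx_scalerAr !weyl_vM.
by rewrite (addrC (shiftv _ j)).
Qed.

Lemma opWW i j : opW i * opW j = opW j * opW i.
Proof.
rewrite /opW -!mx_scalerAl -!mx_scalerAr !weyl_fM.
by rewrite (addrC (sumv _ j)).
Qed.

Lemma weyl_fv f v : weyl 0 f * weyl v 0 = chi (dot f v) *: (weyl v 0 * weyl 0 f).
Proof. by rewrite weylC // dot0l subr0. Qed.

Lemma opWD i j : opW i * opD j = chi (dot (sumv m i) (shiftv m j)) *: (opD j * opW i).
Proof.
rewrite /opW /opD -!mx_scalerAl -!mx_scalerAr weyl_fv !scalerA.
by congr (_ *: _); rewrite mulrC.
Qed.

Lemma opWD_comm i j : (i.+1 < m)%N -> (j.+1 < m)%N -> (j == i.+1) || (i == j.+1) = false ->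
  opW i * opD j = opD j * opW i.
Proof.
move=> im jm /norP/= ; rewrite opWD dot_sumv_shiftv // => [[/negPf-> /negPf->]].
by rewrite subr0 chi0 scale1r.
Qed.

Lemma opWD_adj i j : (i.+1 < m)%N -> (j.+1 < m)%N -> (j == i.+1) || (i == j.+1) ->
  exists2 x, x != 0 & opW i * opD j = chi x *: (opD j * opW i).
Proof.
move=> im jm ij; rewrite opWD dot_sumv_shiftv //; eexists; last by [].
case/orP: ij => /eqP ->; rewrite eqxx.
  by have -> : (i == i.+2) = false by lia.
by have -> : (j == j.+2) = false by lia.
Qed.

Lemma chiN x : chi x * chi (- x) = 1.
Proof. by rewrite -chiD // subrr chi0. Qed.

Lemma twist_inv (a b : 'M[K]_#|V|) x : a * b = chi x *: (b * a) -> b * a = chi (- x) *: (a * b).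
Proof. by move=> ->; rewrite scalerA mulrC chiN scale1r. Qed.

(* The two commuting Temperley-Lieb representations alternate between the shift
   operators [opD] and the phase operators [opW]. *)
Definition letter (b : bool) (i : nat) := if odd i (+) b then opW i else opD i.
Definition proj b i := avg (letter b i).

Lemma letter3 b i : letter b i * letter b i * letter b i = 1.
Proof. by rewrite /letter; case: ifP => _; [exact: opW3|exact: opD3]. Qed.

Lemma proj_idem b i : proj b i * proj b i = proj b i.
Proof. exact/avg_idem/letter3. Qed.

Lemma avg_avg_comm (x y : 'M[K]_#|V|) : x * y = y * x -> avg x * avg y = avg y * avg x.
Proof. by move=> xy; apply: avg_comm; symmetry; apply: avg_comm. Qed.

(** Letters of opposite families are of different kinds only if i and j have the same parity, and
    then they are not neighbours. *)
Lemma projC b i j : (i.+1 < m)%N -> (j.+1 < m)%N ->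
  proj b i * proj (~~ b) j = proj (~~ b) j * proj b i.
Proof.
move=> im jm; apply: avg_avg_comm; rewrite /letter.
case: ifP => bi; case: ifP => bj.
- exact: opWW.
- by apply: opWD_comm => //; lia.
- by symmetry; apply: opWD_comm => //; lia.
- exact: opDD.
Qed.

Lemma proj_far b i j : (i.+1 < m)%N -> (j.+1 < m)%N -> (i.+1 < j)%N || (j.+1 < i)%N ->
  proj b i * proj b j = proj b j * proj b i.
Proof.
move=> im jm ij; apply: avg_avg_comm; rewrite /letter.
case: ifP => bi; case: ifP => bj.
- exact: opWW.
- by apply: opWD_comm => //; lia.
- by symmetry; apply: opWD_comm => //; lia.
- exact: opDD.
Qed.

(** Neighbours in one family have opposite parities, so one is a shift and the other a phase, and
    they commute up to a nontrivial cube root of unity. *)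
Lemma proj_braid b i j : (i.+1 < m)%N -> (j.+1 < m)%N -> (i.+1 == j) || (j.+1 == i) ->
  proj b i * proj b j * proj b i = 3%:R^-1 *: proj b i.
Proof.
move=> im jm ij.
have [x x0 lij] : exists2 x, x != 0 & letter b i * letter b j = chi x *: (letter b j * letter b i).
  rewrite /letter; case: ifP => bi; case: ifP => bj; try lia.
    by apply: opWD_adj => //; lia.
  have [//|//||x x0 /twist_inv] := @opWD_adj j i; first by lia.
  by exists (- x) => //; rewrite oppr_eq0.
have [z1 z2] := chi_neq1 x0.
exact: avg_braid (letter3 b i) z1 z2 lij.
Qed.

(** Replaces the condition that x acts on the strands 0 to k only, without a tensor decomposition:
    commuting with the phase and the shift of strand k + 1 is all that the trace computations
    use. *)
Definition low k (x : 'M[K]_#|V|) :=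
  x * weyl 0 (unitv m k.+1) = weyl 0 (unitv m k.+1) * x /\
  x * weyl (unitv m k.+1) 0 = weyl (unitv m k.+1) 0 * x.

Lemma low_scalar k c : low k c%:M.
Proof. by split; exact/esym/scalar_mxC. Qed.

Lemma lowD k x y : low k x -> low k y -> low k (x + y).
Proof. by move=> [x1 x2] [y1 y2]; split; rewrite mulrDl mulrDr (x1, x2) (y1, y2). Qed.

Lemma lowM k x y : low k x -> low k y -> low k (x * y).
Proof.
by move=> [x1 x2] [y1 y2]; split; rewrite -mulrA (y1, y2) mulrA (x1, x2) mulrA.
Qed.

Lemma lowZ k c x : low k x -> low k (c *: x).
Proof. by rewrite -mul_scalar_mx; apply: lowM (low_scalar k c). Qed.

Lemma low_proj b i k : (i < k)%N -> (k.+1 < m)%N -> low k (proj b i).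
Proof.
move=> ik km.
have: low k (letter b i).
  rewrite /letter; case: ifP => _; apply: lowZ; split.
  - by rewrite !weyl_fM addrC.
  - rewrite weyl_fv dotDl !dot_unitv2 //.
    have [-> ->] : (k.+1 == i) = false /\ (k.+1 == i.+1) = false by lia.
    by rewrite addr0 chi0 scale1r.
  - rewrite [RHS]weyl_fv dotDr dotNr !dot_unitv2 //; try lia.
    have [-> ->] : (i == k.+1) = false /\ (i.+1 == k.+1) = false by lia.
    by rewrite subr0 chi0 scale1r.
  - by rewrite !weyl_vM addrC.
by case=> c1 c2; split; symmetry; apply: avg_comm.
Qed.

(** Conjugation by the phase of strand k + 1 fixes x and multiplies the shift by a nontrivial cube
    root of unity. For [opW] below, the shift of that strand does the same. *)
Lemma mxtrace_avg_opD k x : (k.+1 < m)%N ->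
  x * weyl 0 (unitv m k.+1) = weyl 0 (unitv m k.+1) * x ->
  \tr (x * avg (opD k)) = 3%:R^-1 * \tr x.
Proof.
move=> km xy.
have e : dot (unitv m k.+1) (shiftv m k) = -1.
  rewrite dotDr dotNr !dot_unitv2 // ?(ltnW km) // eqxx.
  by rewrite (_ : k == k.+1 = false) ?add0r //; lia.
have [z1 z2] : chi (-1) != 1 /\ chi (-1) ^+ 2 != 1 by apply: chi_neq1.
apply: (@mxtrace_avg _ _ _ _ (weyl 0 (- unitv m k.+1)) _ _ _ _ z1 z2 xy) => //.
- by rewrite weyl_fM addNr weyl1.
- by rewrite weyl_fM subrr weyl1.
- by rewrite /opD -mx_scalerAr -mx_scalerAl weyl_fv e !scalerA mulrC.
Qed.

Lemma mxtrace_avg_opW k x : (k.+1 < m)%N ->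
  x * weyl (unitv m k.+1) 0 = weyl (unitv m k.+1) 0 * x ->
  \tr (x * avg (opW k)) = 3%:R^-1 * \tr x.
Proof.
move=> km xy.
have e : dot (sumv m k) (unitv m k.+1) = 1.
  rewrite dotDl !dot_unitv2 // eqxx.
  by rewrite (_ : k.+1 == k = false) ?add0r //; lia.
have [z1 z2] : chi (-1) != 1 /\ chi (-1) ^+ 2 != 1 by apply: chi_neq1.
apply: (@mxtrace_avg _ _ _ _ (weyl (- unitv m k.+1) 0) _ _ _ _ z1 z2 xy) => //.
- by rewrite weyl_vM subrr weyl1.
- by rewrite weyl_vM addNr weyl1.
- rewrite /opW -mx_scalerAr -mx_scalerAl; have := weyl_fv (sumv m k) (unitv m k.+1).
  by rewrite e => /twist_inv ->; rewrite !scalerA mulrC.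
Qed.

Lemma mxtrace_proj b k x : (k.+1 < m)%N -> low k x ->
  \tr (x * proj b k) = 3%:R^-1 * \tr x.
Proof.
move=> km [x1 x2]; rewrite /proj /letter.
by case: ifP => _; [exact: mxtrace_avg_opW|exact: mxtrace_avg_opD].
Qed.

(** The shift average is put last and removed first: in front of it, x times the phase average still
    commutes with the phase of strand k + 1. *)
Lemma mxtrace_proj2 k x : (k.+1 < m)%N -> low k x ->
  \tr (x * (proj false k * proj true k)) = 3%:R^-1 * (3%:R^-1 * \tr x).
Proof.
move=> km [x1 x2].
have DW : avg (opD k) * avg (opW k) = avg (opW k) * avg (opD k).
  by apply: avg_avg_comm; symmetry; apply: opWD_comm => //; lia.
have -> : proj false k * proj true k = avg (opW k) * avg (opD k).
  by rewrite /proj /letter addbF addbT; case: (odd k).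
rewrite mulrA mxtrace_avg_opD // ?mxtrace_avg_opW //.
have yW : avg (opW k) * weyl 0 (unitv m k.+1) = weyl 0 (unitv m k.+1) * avg (opW k).
  symmetry; apply: avg_comm.
  by rewrite /opW -mx_scalerAr -mx_scalerAl !weyl_fM addrC.
by rewrite -mulrA yW mulrA x1 mulrA.
Qed.

End Potts.

(** * Temperley-Lieb and BMW representations *)

Section TwelfthRoot.
Variables (K : fieldType) (q : K).
Hypothesis q4 : q ^+ 4 = q ^+ 2 - 1.
Hypothesis n3 : 3%:R != 0 :> K.

(** The hypothesis [q4] makes q a root of the twelfth cyclotomic polynomial. *)
Lemma q_neq0 : q != 0.
Proof.
apply/eqP => q0; move/eqP: q4; rewrite q0 !expr0n /= sub0r eq_sym oppr_eq0.
by rewrite oner_eq0.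
Qed.

Lemma qz_neq0 : q - q^-1 != 0.
Proof.
rewrite subr_eq0; apply/eqP => qV; have q2 : q ^+ 2 = 1 by rewrite expr2 {2}qV mulfV ?q_neq0.
by move/eqP: q4; rewrite (exprM q 2 2) q2 expr1n subrr oner_eq0.
Qed.

Lemma qV2 : q ^- 2 = 1 - q ^+ 2.
Proof.
apply: (mulfI (expf_neq0 2 q_neq0)); rewrite mulfV ?expf_neq0 ?q_neq0 //.
by rewrite mulrBr mulr1 -exprD q4 opprB addrC subrK.
Qed.

Lemma qs2 : (q + q^-1) ^+ 2 = 3%:R.
Proof.
rewrite sqrrD exprVn qV2 mulfV ?q_neq0 //; ring.
Qed.

Lemma qs_neq0 : q + q^-1 != 0.
Proof. by rewrite -sqrf_eq0 qs2. Qed.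

Lemma q6 : q ^+ 6 = -1.
Proof. by rewrite (exprD q 4 2) q4 mulrBl -exprD q4 mul1r addrC addrA addNr sub0r. Qed.

Lemma w_cube : (q ^+ 4) ^+ 3 = 1.
Proof. by rewrite -exprM (exprM q 6 2) q6 sqrrN expr1n. Qed.

Lemma w_neq1 : q ^+ 4 != 1.
Proof.
apply: contraNneq n3 => w1; move: q4; rewrite w1 => /esym/eqP; rewrite subr_eq => /eqP q2.
by move: w1; rewrite (exprM q 2 2) q2 => /eqP; rewrite -subr_eq0 => /eqP <-; apply/eqP; ring.
Qed.

(** Equivalent to (q + q^-1)^2 = 3, since 1 + q^-2 = q^-1 (q + q^-1). It is the condition on c in
    [affine_braidE]. *)
Lemma hecke_coef : (1 + q ^- 2) ^+ 2 = 3%:R * (1 + q ^- 2) - 3%:R.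
Proof.
rewrite qV2; move: q4; rewrite (exprM q 2 2); move: (q ^+ 2) => x x2.
have -> : (1 + (1 - x)) ^+ 2 = 4%:R - 4%:R * x + x ^+ 2 by ring.
by rewrite x2; ring.
Qed.

End TwelfthRoot.

Lemma mulr_swap_mid (A : pzRingType) (b c : A) : b * c = c * b ->
  forall a d, (a * b) * (c * d) = (a * c) * (b * d).
Proof. by move=> bc a d; rewrite -!mulrA (mulrA b) bc !mulrA. Qed.

Lemma mx_mul_scalar (K : comPzRingType) N c (a : 'M[K]_N) : c%:M * a = c *: a.
Proof. exact: mul_scalar_mx. Qed.

Section AffineProj.
Variables (K : fieldType) (N : nat).
Implicit Types (p h x : 'M[K]_N) (c d : K).

Definition affine c p : 'M[K]_N := -1 + c *: p.

Lemma affine_comm c x p : x * p = p * x -> x * affine c p = affine c p * x.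
Proof. by move=> xp; rewrite mulrDl mulrDr mulrN1 mulN1r -mx_scalerAr -mx_scalerAl xp. Qed.

Lemma affine_inv c d p : p * p = p -> c * d = c + d -> affine c p * affine d p = 1.
Proof.
move=> pp cd; rewrite mulrDl !mulrDr !mulN1r mulrN1 opprK mx_scalerM pp cd scalerDl.
by rewrite addKr subrK.
Qed.

Lemma mul_affine c p : p * p = p -> p * affine c p = (c - 1) *: p.
Proof. by move=> pp; rewrite mulrDr mulrN1 -mx_scalerAr pp addrC scalerBl scale1r. Qed.

Lemma affine_sandwich c p h : p * p = p -> p * h * p = 3%:R^-1 *: p ->
  p * affine c h * p = (c / 3%:R - 1) *: p.
Proof.
move=> pp php; rewrite mulrDr mulrDl mulrN1 mulNr pp -mx_scalerAr -mx_scalerAl php.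
by rewrite scalerA addrC scalerBl scale1r.
Qed.

(** The term p h p brings c^3 / 3, which equals c^2 - c by the condition on c, and p is left with
    coefficient c, the same as h. The result is symmetric in p and h, which is the braid
    relation. *)
Lemma affine_braidE c p h : 3%:R != 0 :> K -> c ^+ 2 = 3%:R * c - 3%:R ->
  p * p = p -> p * h * p = 3%:R^-1 *: p ->
  affine c p * affine c h * affine c p =
  -1 + c *: (p + h) - c ^+ 2 *: (p * h + h * p).
Proof.
move=> n3 c2 pp php.
have -> : affine c p * affine c h = 1 - c *: h - c *: p + c ^+ 2 *: (p * h).
  rewrite mulrDl !mulrDr !mulN1r mulrN1 opprK mx_scalerM -expr2.
  by rewrite !addrA.
rewrite !mulrDl mul1r !mulrDr !mulrN1 -!scaleNr !mx_scalerM pp php scalerA.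
move: (p * h) (h * p) => x y; apply/matrixP => a b; rewrite !mxE.
have -> : c ^+ 2 * c * 3^-1 = c ^+ 2 - c.
  by rewrite {1}c2 mulrBl -mulrA -expr2 -mulrBr mulrC mulKf.
by ring.
Qed.

End AffineProj.

(** * Both algebras represented through abstract projections *)

Section Representations.
Variables (K : fieldType) (q : K) (N m : nat).
Hypothesis q4 : q ^+ 4 = q ^+ 2 - 1.
Hypothesis n3 : 3%:R != 0 :> K.

Local Notation M := 'M[K]_N.
Local Notation q0 := (q_neq0 q4).

Variable P : bool -> nat -> M.
Hypothesis pidem : forall b i, P b i * P b i = P b i.
Hypothesis pC : forall b i j, (i.+1 < m)%N -> (j.+1 < m)%N ->
  P b i * P (~~ b) j = P (~~ b) j * P b i.
Hypothesis pfar : forall b i j, (i.+1 < m)%N -> (j.+1 < m)%N ->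
  (i.+1 < j)%N || (j.+1 < i)%N -> P b i * P b j = P b j * P b i.
Hypothesis pbraid : forall b i j, (i.+1 < m)%N -> (j.+1 < m)%N ->
  (i.+1 == j) || (j.+1 == i) -> P b i * P b j * P b i = 3%:R^-1 *: P b i.

Definition hecke b i : M := affine (1 + q ^- 2) (P b i).
Definition heckeV b i : M := affine (1 + q ^+ 2) (P b i).

Definition tl_phi b k (i : 'I_k.-1) : M := P b i.

Lemma hecke_inv b i : hecke b i * heckeV b i = 1.
Proof. by apply: affine_inv; [exact: pidem|field; exact: q0]. Qed.

Lemma heckeV_inv b i : heckeV b i * hecke b i = 1.
Proof. by apply: affine_inv; [exact: pidem|field; exact: q0]. Qed.

Section Pair.
Variables i j : nat.
Hypotheses (im : (i.+1 < m)%N) (jm : (j.+1 < m)%N).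

Lemma proj_affineC c b : P b i * affine c (P (~~ b) j) = affine c (P (~~ b) j) * P b i.
Proof. exact/affine_comm/pC. Qed.

Lemma affine_affineC c d b :
  affine c (P b i) * affine d (P (~~ b) j) = affine d (P (~~ b) j) * affine c (P b i).
Proof. by apply: affine_comm; symmetry; apply: affine_comm; symmetry; exact: pC. Qed.

End Pair.

Definition kg i : M := q *: (hecke false i * hecke true i).
Definition kgV i : M := q^-1 *: (heckeV false i * heckeV true i).
Definition ke i : M := 3%:R *: (P false i * P true i).

Definition bmw_phi k (x : bmw_gen k) : M :=
  match x with
  | BmwG i => kg i
  | BmwGinv i => kgV i
  | BmwE i => ke i
  end.

Lemma hecke_braid b i j : (i.+1 < m)%N -> (j.+1 < m)%N -> (i.+1 == j) || (j.+1 == i) ->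
  hecke b i * hecke b j * hecke b i = hecke b j * hecke b i * hecke b j.
Proof.
move=> im jm ij.
have c2 := hecke_coef q4.
rewrite !affine_braidE //; [|by apply: pbraid => //; rewrite orbC|exact: pbraid].
by rewrite (addrC (P b i)) (addrC (P b i * P b j)).
Qed.

Lemma hecke_pair_inv i : (i.+1 < m)%N ->
  (hecke false i * hecke true i) * (heckeV false i * heckeV true i) = 1.
Proof.
move=> im; rewrite (mulr_swap_mid (affine_affineC im im _ _ true)).
by rewrite !hecke_inv mulr1.
Qed.

Lemma kg_kgV i : (i.+1 < m)%N -> kg i * kgV i = 1.
Proof.
by move=> im; rewrite mx_scalerM hecke_pair_inv // mulfV ?q0 // scale1r.
Qed.

Lemma kgV_kg i : (i.+1 < m)%N -> kgV i * kg i = 1.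
Proof.
move=> im; rewrite mx_scalerM (mulr_swap_mid (affine_affineC im im _ _ true)).
by rewrite !heckeV_inv mulr1 mulVf ?q0 // scale1r.
Qed.

Lemma kg_braid i j : (i.+1 < m)%N -> (j.+1 < m)%N -> (i.+1 == j) || (j.+1 == i) ->
  kg i * kg j * kg i = kg j * kg i * kg j.
Proof.
move=> im jm ij; rewrite !mx_scalerM; congr (_ *: _).
have C k l : (k.+1 < m)%N -> (l.+1 < m)%N ->
    hecke true k * hecke false l = hecke false l * hecke true k.
  by move=> km lm; exact: (affine_affineC km lm _ _ true).
rewrite (mulr_swap_mid (C i j im jm)) (mulr_swap_mid (C j i jm im)).
have CC k l : (k.+1 < m)%N -> (l.+1 < m)%N ->
    hecke true k * hecke true l * hecke false k = hecke false k * (hecke true k * hecke true l).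
  by move=> km lm; rewrite -mulrA C // mulrA C // mulrA.
rewrite (mulr_swap_mid (CC i j im jm)) (mulr_swap_mid (CC j i jm im)).
by congr (_ * _); apply: hecke_braid.
Qed.

Lemma kg_far i j : (i.+1 < m)%N -> (j.+1 < m)%N -> (i.+1 < j)%N || (j.+1 < i)%N ->
  kg i * kg j = kg j * kg i.
Proof.
move=> im jm ij; rewrite !mx_scalerM; congr (_ *: _).
rewrite (mulr_swap_mid (affine_affineC im jm _ _ true)).
rewrite (mulr_swap_mid (affine_affineC jm im _ _ true)).
have far b : hecke b i * hecke b j = hecke b j * hecke b i.
  apply: affine_comm; symmetry; apply: affine_comm; symmetry.
  exact: pfar.
by rewrite (far false) (far true).
Qed.

(** With c = 1 + q^-2 and d = 1 + q^2, both q c and q^-1 d are q + q^-1, so the terms linear in the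
    projections cancel. The term in their product has coefficient 3 (q^-1 - q), whence the factor 3
    in [ke]. *)
Lemma kg_skein i : (i.+1 < m)%N -> kg i - kgV i = (q - q^-1) *: (1 - ke i).
Proof.
move=> im; rewrite /kg /kgV /ke /hecke /heckeV /affine.
rewrite !mulrDl !mulrDr !mulN1r !mulrN1 !opprK !mx_scalerM.
move: (P false i) (P true i) (P false i * P true i) => x y z.
apply/matrixP => a b; rewrite !mxE.
have c1 : q * (1 + q ^- 2) = q + q^-1 by field; exact: q0.
have d1 : q^-1 * (1 + q ^+ 2) = q + q^-1 by field; exact: q0.
have c2 : q * ((1 + q ^- 2) * (1 + q ^- 2)) = 3%:R * q^-1.
  by rewrite -(qs2 q4); field; exact: q0.
have d2 : q^-1 * ((1 + q ^+ 2) * (1 + q ^+ 2)) = 3%:R * q.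
  by rewrite -(qs2 q4); field; exact: q0.
move: (1 + q ^- 2) (1 + q ^+ 2) c1 d1 c2 d2 => c d c1 d1 c2 d2.
move: (x a b) (y a b) (z a b) (nat_of_bool (a == b)) => {}x {}y {}z o.
transitivity ((q - q^-1) * o%:R - (q * c - q^-1 * d) * (x + y)
  + (q * (c * c) - q^-1 * (d * d)) * z); first by ring.
by rewrite c1 d1 c2 d2; ring.
Qed.

(** Each Hecke factor acts on its own projection by q^-2, so the scalar is q q^-4. *)
Lemma ke_kg i : (i.+1 < m)%N -> ke i * kg i = (q ^+ 3)^-1 *: ke i.
Proof.
move=> im; rewrite mx_scalerM (mulr_swap_mid (proj_affineC im im _ true)).
rewrite !mul_affine ?pidem // mx_scalerM !scalerA; congr (_ *: _).
by field; exact: q0.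
Qed.

(** The two families separate, and each contributes c / 3 - 1. *)
Lemma ke_sandwich c i j : (i.+1 < m)%N -> (j.+1 < m)%N -> (i.+1 == j) || (j.+1 == i) ->
  ke i * (affine c (P false j) * affine c (P true j)) * ke i =
  (3%:R * (c / 3%:R - 1) ^+ 2) *: ke i.
Proof.
move=> im jm ij; rewrite -!mx_scalerAl -!mx_scalerAr scalerA.
rewrite (mulr_swap_mid (proj_affineC im jm _ true)).
have C : (P true i * affine c (P true j)) * P false i =
    P false i * (P true i * affine c (P true j)).
  rewrite -mulrA -(@proj_affineC i j im jm c false) mulrA.
  by rewrite -(@pC false i i im im) -mulrA.
rewrite (mulr_swap_mid C) !affine_sandwich ?pidem ?pbraid // mx_scalerM scalerA.
by rewrite scalerA; congr (_ *: _); rewrite expr2; ring.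
Qed.

Lemma ke_kg_ke i j : (i.+1 < m)%N -> (j.+1 < m)%N -> (i.+1 == j) || (j.+1 == i) ->
  ke i * kg j * ke i = q ^+ 3 *: ke i.
Proof.
move=> im jm ij; rewrite -[ke i * kg j]mx_scalerAr -(mx_scalerAl q) ke_sandwich // scalerA.
congr (_ *: _); apply: (mulfI n3).
have -> : 3%:R * (q * (3%:R * ((1 + q ^- 2) / 3%:R - 1) ^+ 2)) =
    q * (1 + q ^- 2 - 3%:R) ^+ 2 by field; rewrite n3 q0.
(* After [qV2] the bracket is -(1 + q^2), whose square is 3 q^2 by [q4]. *)
rewrite (qV2 q4); have -> : (1 + (1 - q ^+ 2) - 3%:R) ^+ 2 = 1 + 2%:R * q ^+ 2 + q ^+ 4 by ring.
by rewrite q4; ring.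
Qed.

Lemma ke_kgV_ke i j : (i.+1 < m)%N -> (j.+1 < m)%N -> (i.+1 == j) || (j.+1 == i) ->
  ke i * kgV j * ke i = (q ^+ 3)^-1 *: ke i.
Proof.
move=> im jm ij; rewrite -[ke i * kgV j]mx_scalerAr -(mx_scalerAl q^-1) ke_sandwich // scalerA.
congr (_ *: _); apply: (mulfI n3).
have -> : 3%:R * (q^-1 * (3%:R * ((1 + q ^+ 2) / 3%:R - 1) ^+ 2)) =
    q^-1 * (1 + q ^+ 2 - 3%:R) ^+ 2 by field; rewrite n3 q0.
have -> : (1 + q ^+ 2 - 3%:R) ^+ 2 = q ^+ 4 - 4%:R * q ^+ 2 + 4%:R by ring.
have -> : (q ^+ 3)^-1 = q^-1 * q ^- 2 by rewrite -invfM -exprS.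
by rewrite (qV2 q4) q4; ring.
Qed.

Lemma bmw_phi_rel k : (k <= m)%N -> forall u v, @bmw_rel K (q ^+ 3) q k u v ->
  ev (@bmw_phi k) u = ev (@bmw_phi k) v.
Proof.
move=> km u v.
have lt (i : 'I_k.-1) : (i.+1 < m)%N by have := ltn_ord i; lia.
case=> {u v} [i|i|i j ij|i j ij|i|i|i j ij|i j ij] /=.
- exact: kg_kgV.
- exact: kgV_kg.
- exact: kg_braid.
- exact: kg_far.
- by rewrite !mx_mul_scalar !scaleN1r kg_skein.
- by rewrite mx_mul_scalar ke_kg.
- by rewrite mx_mul_scalar ke_kg_ke.
- by rewrite mx_mul_scalar ke_kgV_ke.
Qed.

Variable low : nat -> M -> Prop.
Hypothesis low_scalar : forall k c, low k c%:M.
Hypothesis lowD : forall k x y, low k x -> low k y -> low k (x + y).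
Hypothesis lowM : forall k x y, low k x -> low k y -> low k (x * y).
Hypothesis low_proj : forall b i k, (i < k)%N -> (k.+1 < m)%N -> low k (P b i).
Hypothesis tr_proj : forall b k x, (k.+1 < m)%N -> low k x ->
  \tr (x * P b k) = 3%:R^-1 * \tr x.
Hypothesis tr_proj2 : forall k x, (k.+1 < m)%N -> low k x ->
  \tr (x * (P false k * P true k)) = 3%:R^-1 * (3%:R^-1 * \tr x).

Lemma low_scale k c x : low k x -> low k (c *: x).
Proof. by rewrite -mx_mul_scalar; apply: lowM. Qed.

Lemma low_affine c b i k : (i < k)%N -> (k.+1 < m)%N -> low k (affine c (P b i)).
Proof.
move=> ik km; apply: lowD; last exact/low_scale/low_proj.
by rewrite -scaleN1r; apply: low_scale; exact: low_scalar.
Qed.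

Lemma low_pev X (phi : X -> M) (rel : expr K X -> expr K X -> Prop) k (a : presAlg rel) :
  (forall u v, rel u v -> ev phi u = ev phi v) ->
  (forall x, low k (phi x)) -> low k (pev phi a).
Proof.
move=> phi_rel phi_low; elim/presAlg_ind: a => [c|x|a b la lb|a b la lb].
- by rewrite pevZ // pev1 //; apply: low_scale; exact: low_scalar.
- by rewrite pev_gen.
- by rewrite pevD //; apply: lowD.
- by rewrite pevM //; apply: lowM.
Qed.

Lemma tr_ke k x : (k.+1 < m)%N -> low k x -> \tr (x * ke k) = 3%:R^-1 * \tr x.
Proof.
by move=> km lx; rewrite -mx_scalerAr mxtraceZ tr_proj2 // mulVKf.
Qed.

Lemma tr_affine2 c k x : (k.+1 < m)%N -> low k x ->
  \tr (x * (affine c (P false k) * affine c (P true k))) = (c / 3%:R - 1) ^+ 2 * \tr x.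
Proof.
move=> km lx; rewrite /affine !mulrDl !mulrDr !mulN1r !mulrN1 !opprK mx_scalerM.
rewrite mulr1 !mulrN -!mx_scalerAr !raddfD /= !raddfN /= !mxtraceZ !tr_proj // tr_proj2 //.
by field.
Qed.

Lemma tr_kg k x : (k.+1 < m)%N -> low k x -> \tr (x * kg k) = q ^+ 3 / 3%:R * \tr x.
Proof.
move=> km lx; rewrite -mx_scalerAr mxtraceZ tr_affine2 // mulrA; congr (_ * _).
have -> c : (c / 3%:R - 1) ^+ 2 = (c ^+ 2 / 3%:R - 2%:R * c) / 3%:R + 1 :> K by field.
rewrite (hecke_coef q4) (qV2 q4).
have -> : q ^+ 3 = q * q ^+ 2 by rewrite exprS.
by field.
Qed.

Lemma tl_phi_rel b k : (k <= m)%N -> forall u v, @tl_rel K q k u v ->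
  ev (@tl_phi b k) u = ev (@tl_phi b k) v.
Proof.
move=> km u v.
have lt (i : 'I_k.-1) : (i.+1 < m)%N by have := ltn_ord i; lia.
case=> {u v} [i|i j ij|i j ij] /=.
- exact: pidem.
- by rewrite (qs2 q4) mx_mul_scalar /tl_phi pbraid.
- by rewrite /tl_phi pfar.
Qed.

Local Notation bmwA := (bmw (q ^+ 3) q).
Local Notation bmwE k := (pev (rel := @bmw_rel K (q ^+ 3) q k) (@bmw_phi k)).

Lemma bmwE_incl k (a : bmwA k) : (k < m)%N -> bmwE k.+1 (bmw_incl a) = bmwE k a.
Proof.
move=> km; rewrite /bmw_incl pev_phom; last exact: bmw_phi_rel.
by apply: eq_ev; case.
Qed.

Lemma low_bmwE k (a : bmwA k.+1) : (k.+1 < m)%N -> low k (bmwE k.+1 a).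
Proof.
move=> km; apply: low_pev => [|x]; first exact/bmw_phi_rel/ltnW.
have lP b (i : 'I_k) : low k (P b i) by apply: low_proj.
by case: x => i; apply: low_scale; apply: lowM => //; apply: low_affine.
Qed.

(** The matrices have the same size N for every k, so their trace does not change under inclusion
    and N is the only normalization. Both sides satisfy the same recursion over the shapes of
    [bmw_normal_ind], down to one strand, where the algebra is scalar. *)
Lemma bmw_trace_unique (tr : forall k, {scalar bmwA k}) : bmw_markov_trace tr ->
  forall k, (k < m)%N -> forall a : bmwA k.+1, \tr (bmwE k.+1 a) = N%:R * tr k.+1 a.
Proof.
move=> trP; have [tr1 trC trg _ tre] := trP; elim=> [|k IHk] km a.
  have [|c ->] := @presAlg_scalar _ _ _ _ a; first by case=> [] [].
  rewrite pevZ ?pev1; try exact: bmw_phi_rel.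
  by rewrite mxtraceZ mxtrace1 linearZ /= tr1 mulr1 mulrC.
have rel1 := bmw_phi_rel (ltnW km); have rel2 := bmw_phi_rel km.
have r0 : q ^+ 3 != 0 by rewrite expf_neq0 ?q0.
(* The loop value at r = q^3: the quotient is q^2 + 1 + q^-2, and q^2 + q^-2 = 1. *)
have zE : 1 + (q ^+ 3 - (q ^+ 3)^-1) / (q - q^-1) = 3%:R.
  have -> : (q ^+ 3 - (q ^+ 3)^-1) = (q ^+ 2 + 1 + q ^- 2) * (q - q^-1) by field; exact: q0.
  by rewrite mulfK ?(qz_neq0 q4) // (qV2 q4); ring.
elim/(@bmw_normal_ind K (q ^+ 3) q k (qz_neq0 q4) r0): a => [c a IHa|a b IHa IHb|a|a b|a b].
- by rewrite pevZ // mxtraceZ IHa linearZ /= mulrCA.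
- by rewrite pevD // !raddfD /= IHa IHb mulrDr.
- by rewrite bmwE_incl // IHk ?(ltnW km) // (bmw_trace_incl (qz_neq0 q4) zE n3 trP).
- rewrite [in RHS]trC mulrA -[bmw_incl b * _]phomM; last exact: bmw_widen_rel.
  rewrite trg !(pevM rel2) !bmwE_incl // pev_gen // mxtrace_mulC mulmxE mulrA tr_kg //.
    by rewrite mulrCA -IHk ?(ltnW km) // (pevM rel1).
  by apply: lowM; apply: low_bmwE.
- rewrite [in RHS]trC mulrA -[bmw_incl b * _]phomM; last exact: bmw_widen_rel.
  rewrite tre !(pevM rel2) !bmwE_incl // pev_gen // mxtrace_mulC mulmxE mulrA tr_ke //.
    by rewrite mulrCA -IHk ?(ltnW km) // (pevM rel1).
  by apply: lowM; apply: low_bmwE.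
Qed.

Local Notation tlE b k := (pev (rel := @tl_rel K q k) (@tl_phi b k)).

Lemma tlE_incl b k (a : tl q k) : (k < m)%N -> tlE b k.+1 (tl_incl a) = tlE b k a.
Proof. by move=> km; rewrite /tl_incl pev_phom //; exact: tl_phi_rel. Qed.

Lemma low_tlE b k (a : tl q k.+1) : (k.+1 < m)%N -> low k (tlE b k.+1 a).
Proof.
move=> km; apply: low_pev => [|x]; first exact/tl_phi_rel/ltnW.
exact: low_proj.
Qed.

Lemma tlE_commP k (x : tl q k) b j : (k <= m)%N -> (j.+1 < m)%N ->
  P b j * tlE (~~ b) k x = tlE (~~ b) k x * P b j.
Proof.
move=> km jm; have rel c := tl_phi_rel c km.
elim/presAlg_ind: x => [c|i|x y Cx Cy|x y Cx Cy].
- by rewrite (pevZ (rel _)) (pev1 (rel _)) -mx_scalerAr -mx_scalerAl mulr1 mul1r.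
- by rewrite (pev_gen (rel _)); apply: pC => //; have := ltn_ord i; lia.
- by rewrite (pevD (rel _)) mulrDl mulrDr Cx Cy.
- by rewrite (pevM (rel _)) mulrA Cx -(mulrA _ (P b j)) Cy mulrA.
Qed.

Lemma tlE_comm k l (x : tl q k) (y : tl q l) b : (k <= m)%N -> (l <= m)%N ->
  tlE b l y * tlE (~~ b) k x = tlE (~~ b) k x * tlE b l y.
Proof.
move=> km lm; have rel c := tl_phi_rel c lm.
elim/presAlg_ind: y => [c|i|y z Cy Cz|y z Cy Cz].
- by rewrite (pevZ (rel _)) (pev1 (rel _)) -mx_scalerAr -mx_scalerAl mulr1 mul1r.
- by rewrite (pev_gen (rel _)); apply: tlE_commP => //; have := ltn_ord i; lia.
- by rewrite (pevD (rel _)) mulrDl mulrDr Cy Cz.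
- by rewrite (pevM (rel _)) -mulrA Cz mulrA Cy mulrA.
Qed.

(** The square of the Jones polynomial needs the trace of a product of the two families, so x and y
    are reduced together. The cases are whether each of them contains its top projection; the
    induction hypothesis is applied to products of the remaining factors. *)
Lemma tl_trace_unique (tr : forall k, {scalar tl q k}) : tl_markov_trace tr ->
  forall k, (k < m)%N -> forall x y : tl q k.+1,
  \tr (tlE false k.+1 x * tlE true k.+1 y) = N%:R * (tr k.+1 x * tr k.+1 y).
Proof.
move=> trP; have [tr1 trC trp] := trP; elim=> [|k IHk] km x y.
  have rel b := tl_phi_rel b km.
  have [|c ->] := @presAlg_scalar _ _ _ _ x; first by case=> [].
  have [|d ->] := @presAlg_scalar _ _ _ _ y; first by case=> [].
  rewrite !(pevZ (rel _)) !(pev1 (rel _)) !linearZ /= tr1 mx_scalerM mulr1 mxtraceZ mxtrace1.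
  by rewrite !mulr1 mulrC.
have rel1 b := tl_phi_rel b (ltnW km); have rel2 b := tl_phi_rel b km.
have km1 := ltnW km.
have top a b : tr k.+2 (tl_incl a * @tl_p _ q k.+2 ord_max * tl_incl b) = 3%:R^-1 * tr k.+1 (b * a).
  by rewrite trC mulrA -[tl_incl b * _]phomM ?trp ?(qs2 q4) //; exact: tl_widen_rel.
have inc := tl_trace_incl (qs_neq0 q4 n3) trP.
have lE b a := @low_tlE b k a km.
have CP z b : P b k * tlE (~~ b) k.+1 z = tlE (~~ b) k.+1 z * P b k by apply: tlE_commP.
have CE z z' b : tlE b k.+1 z' * tlE (~~ b) k.+1 z = tlE (~~ b) k.+1 z * tlE b k.+1 z'.
  exact: tlE_comm.
have low2 a b : low k (tlE true k.+1 a * tlE false k.+1 b) by apply: lowM.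
elim/tl_normal_ind: x => [c x IHx|x x' IHx IHx'|a|a b].
- by rewrite (pevZ (rel2 _)) linearZ /= -mx_scalerAl mxtraceZ IHx mulrCA !mulrA.
- by rewrite (pevD (rel2 _)) linearD /= mulrDl mxtraceD IHx IHx' mulrDl mulrDr.
- elim/tl_normal_ind: y => [d y IHy|y y' IHy IHy'|a'|a' b'].
  + by rewrite (pevZ (rel2 _)) linearZ /= -mx_scalerAr mxtraceZ IHy mulrCA (mulrCA d).
  + by rewrite (pevD (rel2 _)) linearD /= mulrDr mxtraceD IHy IHy' !mulrDr.
  + by rewrite !tlE_incl // !inc IHk.
  + rewrite inc top !(pevM (rel2 _)) !tlE_incl // (pev_gen (rel2 _)) !mulrA.
    rewrite mxtrace_mulC mulmxE !mulrA tr_proj //; last by apply: lowM => //; apply: lowM.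
    rewrite -(CE _ _ false) -(mulrA (tlE false _ _)) -(pevM (rel1 _)) IHk //; ring.
- rewrite top !(pevM (rel2 _)) !tlE_incl // (pev_gen (rel2 _)).
  have lowF c : low k (tlE false k.+1 c) by [].
  have lowT c : low k (tlE true k.+1 c) by [].
  elim/tl_normal_ind: y => [d y IHy|y y' IHy IHy'|a'|a' b'].
  + by rewrite (pevZ (rel2 _)) linearZ /= -mx_scalerAr mxtraceZ IHy mulrCA (mulrCA d).
  + by rewrite (pevD (rel2 _)) linearD /= mulrDr mxtraceD IHy IHy' !mulrDr.
  + rewrite tlE_incl // inc -(mulrA _ (tlE false _ b)) mxtrace_mulC mulmxE (mulrA _ (tlE false _ a)).
    rewrite tr_proj //; last by do 2?apply: lowM.
    rewrite -(mulrA (tlE false _ b)) -(CE _ _ false) mulrA -(pevM (rel1 _)) IHk //; ring.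
  + rewrite top !(pevM (rel2 _)) !tlE_incl // (pev_gen (rel2 _))
      -[tl_phi true _]/(P true k) -[tl_phi false _]/(P false k).
    set A := tlE false _ a; set B := tlE false _ b.
    set C := tlE true _ a'; set D := tlE true _ b'.
    have [lA lB] : low k A /\ low k B := conj (lowF a) (lowF b).
    have [lC lD] : low k C /\ low k D := conj (lowT a') (lowT b').
    have BP : B * P true k = P true k * B := esym (CP _ true).
    have PC : P false k * C = C * P false k := CP _ false.
    have BC : B * C = C * B := CE _ _ false.
    have BD : B * D = D * B := CE _ _ false.
    have AD : A * D = D * A := CE _ _ false.
    (* The factors are regrouped so that the two top projections stand side by side and [tr_proj2]
       removes both. What remains sorts again into a product of the two families. *)
    have -> : A * P false k * B * (C * P true k * D) = (A * C * (P false k * P true k)) * (D * B).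
      by rewrite -BD !mulrA -(mulrA A C) -PC !mulrA
        -(mulrA _ (P true k) B) -BP !mulrA -(mulrA _ C B) -BC !mulrA.
    rewrite mxtrace_mulC mulmxE (mulrA (D * B)) tr_proj2 //; last by do 2!apply: lowM.
    have -> : D * B * (A * C) = (B * A) * (D * C) by rewrite -BD -!mulrA (mulrA A) AD !mulrA.
    rewrite -!(pevM (rel1 _)) IHk //; ring.
Qed.

End Representations.

(** * The braid representation of R_3 *)

Section BraidWords.
Variables (K : fieldType) (N n : nat).

Lemma writhe_cons s (xi : braid n) : writhe (s :: xi) = (if s.2 then 1 else -1) + writhe xi.
Proof. exact: big_cons. Qed.

Lemma braid_image_cons (A : pzRingType) (f f' : 'I_n.-1 -> A) s xi :
  braid_image f f' (s :: xi) = (if s.2 then f s.1 else f' s.1) * braid_image f f' xi.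
Proof. exact: big_cons. Qed.

Lemma braid_image_nil (A : pzRingType) (f f' : 'I_n.-1 -> A) : braid_image f f' [::] = 1.
Proof. exact: big_nil. Qed.

Lemma eq_braid_image (A : pzRingType) (f f' h h' : 'I_n.-1 -> A) :
  f =1 h -> f' =1 h' -> braid_image f f' =1 braid_image h h'.
Proof. by move=> fh fh' xi; apply: eq_bigr => s _; rewrite fh fh'. Qed.

Lemma braid_image_scale (c : K) (f f' : 'I_n.-1 -> 'M[K]_N) xi : c != 0 ->
  braid_image (fun i => c *: f i) (fun i => c^-1 *: f' i) xi =
  c ^ writhe xi *: braid_image f f' xi.
Proof.
move=> c0; elim: xi => [|[i b] xi IHxi].
  by rewrite !braid_image_nil /writhe big_nil expr0z scale1r.
rewrite !braid_image_cons IHxi writhe_cons /= expfzDr //.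
by case: b; rewrite mx_scalerM.
Qed.

Lemma pev_braid_image X (rel : expr K X -> expr K X -> Prop) (phi : X -> 'M[K]_N)
    (f f' : 'I_n.-1 -> presAlg rel) xi :
  (forall u v, rel u v -> ev phi u = ev phi v) ->
  pev phi (braid_image f f' xi) = braid_image (fun i => pev phi (f i)) (fun i => pev phi (f' i)) xi.
Proof.
move=> phi_rel; elim: xi => [|[i b] xi IHxi].
  by rewrite !braid_image_nil pev1.
by rewrite !braid_image_cons pevM // IHxi; case: b.
Qed.

Lemma braid_image_mul (A : pzRingType) (f f' h h' : 'I_n.-1 -> A) xi :
  (forall i j, [/\ h i * f j = f j * h i, h i * f' j = f' j * h i,
     h' i * f j = f j * h' i & h' i * f' j = f' j * h' i]) ->
  braid_image f f' xi * braid_image h h' xi =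
  braid_image (fun i => f i * h i) (fun i => f' i * h' i) xi.
Proof.
move=> fh; elim: xi => [|[i b] xi IHxi]; first by rewrite !braid_image_nil mulr1.
have C : (if b then h i else h' i) * braid_image f f' xi =
    braid_image f f' xi * (if b then h i else h' i).
  elim: xi {IHxi} => [|[j d] xi IHxi]; first by rewrite braid_image_nil mulr1 mul1r.
  rewrite !braid_image_cons mulrA -[RHS]mulrA -IHxi !mulrA; congr (_ * _).
  by have [? ? ? ?] := fh i j; case: b {IHxi}; case: d.
rewrite !braid_image_cons -IHxi !mulrA; congr (_ * _).
by rewrite -mulrA -C mulrA; case: b C.
Qed.
End BraidWords.

Lemma sum_F3 (A : nmodType) (F : 'F_3 -> A) : \sum_t F t = F 0 + F 1 + F 2%:R.
Proof.
rewrite !big_ord_recl big_ord0 addr0 addrA.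
by congr (F _ + F _ + F _); apply: val_inj.
Qed.

Lemma F3_ind (P : 'F_3 -> Prop) : P 0 -> P 1 -> P 2%:R -> forall t, P t.
Proof.
move=> P0 P1 P2 [[|[|[|//]]] t3].
- by have -> : Ordinal t3 = 0 by apply: val_inj.
- by have -> : Ordinal t3 = 1 by apply: val_inj.
- by have -> : Ordinal t3 = 2%:R by apply: val_inj.
Qed.

(** * Gauss sums and the entries of R_3 *)

Section RMatrix.
Variables (K : fieldType) (q : K) (n : nat).
Hypothesis q4 : q ^+ 4 = q ^+ 2 - 1.
Hypothesis n3 : 3%:R != 0 :> K.

Local Notation w := (q ^+ 4).
Local Notation V := {ffun 'I_n.+1 -> 'F_3}.
Local Notation c := (1 + q ^- 2).

(** The coefficient of the t-fold shift in -1 + c avg([opD]); the factor w^t comes from the phase w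
    built into [opD]. *)
Definition gauss (t : 'F_3) : K := if t == 0 then c / 3%:R - 1 else c / 3%:R * w ^+ t.

Lemma affine_avg_opDE i (a b : 'I_#|V|) :
  affine c (avg (@opD K w n.+1 i)) a b =
  \sum_(t : 'F_3) if enum_val a == enum_val b + shiftv n.+1 i *+ t then gauss t else 0.
Proof.
set v := shiftv n.+1 i; rewrite sum_F3.
have v1 : v *+ (1%R : 'F_3) = v by [].
have v2 : v *+ (2%:R%R : 'F_3) = v + v by [].
rewrite v1 v2 addr0.
have -> : gauss 0 = c / 3%:R - 1 by [].
have -> : gauss 1 = c / 3%:R * w by [].
have -> : gauss 2%:R = c / 3%:R * w ^+ 2 by [].
rewrite /affine /avg mx_scalerM weyl_vM ?w_cube // !mxE !dot0l !chi0.
rewrite (inj_eq enum_val_inj) -/v; move: c w => d u.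
by case: (a == b); case: (_ == _); case: (_ == _); rewrite ?mulr0n ?mulr1n; field.
Qed.

(** The Fourier transform of [gauss]: the eigenvalue of -1 + c avg([opW]) on basis vectors whose two
    entries add up to s. *)
Definition gaussW (s : 'F_3) : K := \sum_t gauss t * chi w (t * s).

Lemma affine_avg_opWE i (a b : 'I_#|V|) :
  affine c (avg (@opW K w n.+1 i)) a b =
  if a == b then gaussW (dot (sumv n.+1 i) (enum_val b)) else 0.
Proof.
set f := sumv n.+1 i; rewrite /gaussW sum_F3 !mul0r !mul1r chi0 mulr1.
have -> : gauss 0 = c / 3%:R - 1 by [].
have -> : gauss 1 = c / 3%:R * w by [].
have -> : gauss 2%:R = c / 3%:R * w ^+ 2 by [].
rewrite /affine /avg mx_scalerM weyl_fM ?w_cube // !mxE !addr0 dotDl.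
have -> : 2%:R * dot f (enum_val b) = dot f (enum_val b) + dot f (enum_val b).
  by rewrite mulr_natl.
rewrite (inj_eq enum_val_inj) -/f; case: (a == b).
  rewrite mulr1n !chiD ?w_cube //; move: (chi w (dot f (enum_val b))) => h.
  by move: c w => d u; field.
by rewrite mulr0n !mulr0 !addr0 !mulr0 oppr0 addr0.
Qed.

(** For t = 1, 2 the exponents agree modulo 3. For t = 0 the claim is c / 3 - 1 = (c / 3) w^2, which
    is where the special value of c enters. *)
Lemma gaussE t : gauss t = q^-1 / (q + q^-1) * w ^+ 2 * chi w (t ^+ 2 + t).
Proof.
have q0 := q_neq0 q4; have s0 := qs_neq0 q4 n3.
have cE : c = q^-1 * (q + q^-1) by field.
have c3 : c / 3%:R = q^-1 / (q + q^-1).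
  by rewrite cE -(qs2 q4); move: (q + q^-1) s0 => s0' ?; field; apply/andP.
have w2 : w ^+ 2 = - q ^+ 2 by rewrite -exprM (exprD q 6 2) (q6 q4) mulN1r.
have qs : q * (q + q^-1) = q ^+ 2 + 1 by rewrite mulrDr mulfV // -expr2.
have c31 : c / 3%:R - 1 = q^-1 / (q + q^-1) * w ^+ 2.
  rewrite c3 w2; apply: (mulfI s0); apply: (mulfI q0).
  rewrite mulrBr mulr1 mulrBr qs; move: (q + q^-1) s0 => s s0.
  have -> : q * (s * (q^-1 / s)) = 1 by field; apply/andP.
  have -> : q * (s * (q^-1 / s * - q ^+ 2)) = - q ^+ 2 by field; apply/andP.
  by rewrite opprD addrCA subrr addr0.
elim/F3_ind: t.
- by rewrite {1}/gauss eqxx c31 expr0n addr0 chi0 mulr1.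
- rewrite {1}/gauss c3 -[RHS]mulrA -exprD; congr (_ * _).
  by rewrite -[RHS]/(w ^+ (3 + 1)) exprD (w_cube q4) mul1r.
- by rewrite {1}/gauss c3 -[chi _ _]/1 mulr1.
Qed.

(** A quadratic Gauss sum: the Fourier transform of a quadratic phase is again one. For each of the
    three values of s the difference of the two sides is a multiple of w^2 + w + 1. *)
Lemma gaussWE s : gaussW s = q^-1 / (q + q^-1) * (w ^+ 2 - 1) * chi w (- s ^+ 2 + s).
Proof.
rewrite /gaussW sum_F3 !gaussE.
have wK := w_cube q4.
have w21 : w ^+ 2 = - 1 - w.
  have -> : w ^+ 2 = - q ^+ 2 by rewrite -exprM (exprD q 6 2) (q6 q4) mulN1r.
  by rewrite q4; ring.
have c0 : chi w (0 ^+ 2 + 0) = 1 by [].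
have c1 : chi w (1 ^+ 2 + 1) = w ^+ 2 by [].
have c2 : chi w (2%:R ^+ 2 + 2%:R) = 1 by [].
rewrite c0 c1 c2 {c0 c1 c2}; move: (q^-1 / _) => k.
have {}w21 : w ^+ 2 + w + 1 = 0 by rewrite w21; ring.
have x0 : chi w 0 = 1 by [].
have x1 : chi w 1 = w by rewrite -[LHS]/(w ^+ 1).
have x2 : chi w 2%:R = w ^+ 2 by [].
apply/eqP; rewrite -subr_eq0; apply/eqP; elim/F3_ind: s.
- rewrite [chi w (0 * 0)]x0 [chi w (1 * 0)]x0 [chi w (2%:R * 0)]x0 [chi w (- _ + _)]x0.
  move: w w21 => u u0.
  transitivity (k * (u ^+ 2 - u + 1) * (u ^+ 2 + u + 1)); first by ring.
  by rewrite u0 mulr0.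
- rewrite [chi w (0 * 1)]x0 [chi w (1 * 1)]x1 [chi w (2%:R * 1)]x2 [chi w (- _ + _)]x0.
  move: w w21 => u u0.
  transitivity (k * (u ^+ 3 - u + 1) * (u ^+ 2 + u + 1)); first by ring.
  by rewrite u0 mulr0.
- rewrite [chi w (0 * _)]x0 [chi w (1 * _)]x2 [chi w (2%:R * 2%:R)]x1 [chi w (- _ + _)]x1.
  move: w w21 => u u0.
  transitivity (k * (u ^+ 4 - u ^+ 3 + u) * (u ^+ 2 + u + 1)); first by ring.
  by rewrite u0 mulr0.
Qed.

(** With s = x + y this is the coefficient of R_3. The constants collapse to 1 / (q + q^-1), because
    w^2 (w^2 - 1) = q^3 (q + q^-1). *)
Lemma gauss_mul t s : q^-1 * (gauss t * gaussW s) =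
  (q + q^-1)^-1 * w ^+ (t ^+ 2 + t - s ^+ 2 + s)%R.
Proof.
have q0 := q_neq0 q4; have s0 := qs_neq0 q4 n3.
rewrite -[w ^+ _]/(chi w (t ^+ 2 + t - s ^+ 2 + s)) -addrA chiD ?(w_cube q4) //.
rewrite gaussE gaussWE; move: (chi w _) (chi w _) => x y.
have wq : w ^+ 2 * (w ^+ 2 - 1) = q ^+ 3 * (q + q^-1).
  have -> : q ^+ 3 * (q + q^-1) = q ^+ 4 + q ^+ 2 by field.
  have -> : w ^+ 2 = - q ^+ 2 by rewrite -exprM (exprD q 6 2) (q6 q4) mulN1r.
  by rewrite mulNr mulrBr mulrN -exprD mulr1 opprB opprK addrC.
transitivity (q^-1 * (q^-1 / (q + q^-1)) * (q^-1 / (q + q^-1)) *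
  (w ^+ 2 * (w ^+ 2 - 1)) * x * y); first by ring.
rewrite wq; move: (q + q^-1) s0 => s' s0.
by field; apply/andP.
Qed.

End RMatrix.

Lemma shiftv_eq n (i : 'I_n) (a x : {ffun 'I_n.+1 -> 'F_3}) (t : 'F_3)
    (l := widen_ord (leqnSn n) i) (l' := lift ord0 i) :
  (a == x + shiftv n.+1 i *+ t) =
  [forall k, (k != l) && (k != l') ==> (a k == x k)] && ((a l == x l + t) && (a l' == x l' - t)).
Proof.
have vE k : (shiftv n.+1 i *+ t) k = ((k == l)%:R - (k == l')%:R) *+ t.
  rewrite ffunMnE !ffunE; congr ((_ - _%:R) *+ t).
have tE : (1 : 'F_3) *+ t = t by rewrite natr_Zp.
have ll' : (l == l') = false by rewrite -val_eqE /= /bump /=; lia.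
apply/eqP/andP => [->|[/forallP ax /andP[/eqP al /eqP al']]].
  rewrite !ffunE !vE !eqxx ll' (eq_sym l') ll' subr0 sub0r mulNrn tE !eqxx; split=> //.
  apply/forallP => k; apply/implyP => /andP[/negPf kl /negPf kl'].
  by rewrite ffunE vE kl kl' subr0 mul0rn addr0.
apply/ffunP => k; rewrite ffunE vE.
have [->|kl] := eqVneq k l; first by rewrite ll' subr0 tE.
have [->|kl'] := eqVneq k l'; first by rewrite sub0r mulNrn tE.
by rewrite subr0 mul0rn addr0; apply/eqP; have := ax k; rewrite kl kl'.
Qed.

Lemma dot_sumv n (i : 'I_n) (x : {ffun 'I_n.+1 -> 'F_3}) :
  dot (sumv n.+1 i) x = x (widen_ord (leqnSn n) i) + x (lift ord0 i).
Proof.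
have dotC f : dot f x = dot x f by apply: eq_bigr => k _; rewrite mulrC.
by rewrite dotC dotDr -(dot_unitv x (widen_ord (leqnSn n) i)) -(dot_unitv x (@lift n.+1 ord0 i)).
Qed.

Section RMatrixProduct.
Variables (K : fieldType) (q : K) (n : nat).
Hypothesis q4 : q ^+ 4 = q ^+ 2 - 1.
Hypothesis n3 : 3%:R != 0 :> K.
Local Notation w := (q ^+ 4).
Local Notation V := {ffun 'I_n.+1 -> 'F_3}.
Local Notation c := (1 + q ^- 2).

Lemma avg_opD_opWE i (a b : 'I_#|V|) :
  (affine c (avg (@opD K w n.+1 i)) * affine c (avg (@opW K w n.+1 i))) a b =
  \sum_(t : 'F_3) if enum_val a == enum_val b + shiftv n.+1 i *+ t
    then gauss q t * gaussW q (dot (sumv n.+1 i) (enum_val b)) else 0.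
Proof.
rewrite mxE (bigD1 b) //= big1 ?addr0 => [|k kb].
  rewrite affine_avg_opDE // affine_avg_opWE // eqxx mulr_suml.
  by apply: eq_bigr => t _; case: ifP; rewrite ?mul0r.
by rewrite affine_avg_opWE // (negPf kb) mulr0.
Qed.

(** For odd i the first family supplies the phase, and the two factors have to be exchanged. *)
Lemma hecke_opD_opW i : (i < n)%N ->
  hecke q (@proj K w n.+1) false i * hecke q (@proj K w n.+1) true i =
  affine c (avg (opD w n.+1 i)) * affine c (avg (opW w n.+1 i)).
Proof.
move=> im; rewrite /hecke /proj /letter addbF addbT.
case: (odd i); last by [].
apply: affine_comm; symmetry; apply: affine_comm.
by apply: avg_avg_comm; symmetry; apply: opWD_comm; rewrite ?(w_cube q4) ?(w_neq1 q4) //; lia.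
Qed.

End RMatrixProduct.

(** * The complex constants and the factorization of R_3 *)

Section RealRoot.
Variable R : realType.
Local Notation C := R[i].
Local Notation q := (qB R).

Lemma three_neq0 : 3%:R != 0 :> C.
Proof. by rewrite pnatr_eq0. Qed.

Lemma expiX t k : expi (t *+ k) = expi t ^+ k :> C.
Proof.
elim: k => [|k IHk]; first by rewrite mulr0n /expi cos0 sin0.
by rewrite mulrS expiD IHk exprS.
Qed.

Lemma cos_pi6_gt0 : 0 < cos (pi / 6 : R).
Proof.
have pi0 := pi_gt0 R; apply: cos_gt0_pihalf; apply/andP; split; lra.
Qed.

Lemma omegaE : omega R = q ^+ 4.
Proof. by rewrite /qB -expiX /omega; congr expi; field. Qed.

(** From q^3 = i follows q^6 + 1 = 0, which factors as (q^2 + 1)(q^4 - q^2 + 1). The first factor is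
    nonzero: otherwise -q = i, although q has positive real part. *)
Lemma qB4 : q ^+ 4 = q ^+ 2 - 1.
Proof.
have q3 : q ^+ 3 = 'i%C by rewrite -rBE.
have q6 : q ^+ 6 = -1 by rewrite (exprM q 3 2) q3; exact: sqr_i.
have q2 : q ^+ 2 + 1 != 0.
  rewrite addr_eq0; apply/eqP => q2; move: q3; rewrite exprSr q2 mulN1r.
  move=> /(congr1 (@complex.Re R)) /eqP.
  by rewrite /= oppr_eq0 gt_eqF // cos_pi6_gt0.
apply/eqP; rewrite -subr_eq0 opprB addrA; apply/eqP/(mulfI q2); rewrite mulr0.
by transitivity (q ^+ 6 + 1); [ring|rewrite q6 addNr].
Qed.

Lemma qB_conj : q + q^-1 = (2 * cos (pi / 6))%:C%C.
Proof.
have qV : q^-1 = expi (- (pi / 6)).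
  apply: (mulfI (q_neq0 qB4)); rewrite mulfV ?(q_neq0 qB4) //.
  by rewrite /qB -expiD subrr /expi cos0 sin0.
by rewrite qV /qB /expi cosN sinN; apply/eqP; rewrite eq_complex /= subrr eqxx andbT mulr_natl mulr2n.
Qed.

(** The square is 3 by [qs2]; positivity of the cosine selects the root. *)
Lemma qB_sqrt3 : q + q^-1 = (Num.sqrt 3)%:C%C.
Proof.
rewrite qB_conj; congr (_%:C)%C.
have c0 : 0 <= 2 * cos (pi / 6) :> R by rewrite mulr_ge0 // ltW // cos_pi6_gt0.
have cc : (2 * cos (pi / 6)) ^+ 2 = 3 :> R.
  have := qs2 qB4; rewrite qB_conj -rmorphXn /= => /(congr1 (@complex.Re R)) /= ->.
  by rewrite addrA -mulr2n -mulrSr.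
by rewrite -cc sqrtr_sqr ger0_norm.
Qed.

Lemma R3_at_hecke n (i : 'I_n) :
  R3_at R i = q^-1 *:
    (hecke q (@proj C (q ^+ 4) n.+1) false i * hecke q (@proj C (q ^+ 4) n.+1) true i).
Proof.
rewrite (hecke_opD_opW qB4 three_neq0 (ltn_ord i)).
apply/matrixP => a b; rewrite mxE [RHS]mxE (avg_opD_opWE qB4 three_neq0).
rewrite mulr_sumr; under [RHS]eq_bigr => t _ do rewrite shiftv_eq.
cbv zeta; case: [forall k, _] => /=; last by rewrite big1 // => t _; rewrite mulr0.
rewrite /R3 big_mkcond mulr_sumr /=; apply: eq_bigr => t _.
case: ifP => _; last by rewrite !mulr0.
rewrite (gauss_mul qB4 three_neq0) dot_sumv qB_sqrt3 omegaE fmorphV.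
by [].
Qed.

End RealRoot.

(** * Images of braid words and comparison of the invariants *)

Section PottsWords.
Variables (K : fieldType) (q : K) (n : nat).
Hypothesis q4 : q ^+ 4 = q ^+ 2 - 1.
Hypothesis n3 : 3%:R != 0 :> K.
Local Notation w := (q ^+ 4).
Local Notation P := (@proj K w n.+1).
Local Notation N := #|{ffun 'I_n.+1 -> 'F_3}|.
Local Notation w3 := (w_cube q4).
Local Notation w1 := (w_neq1 q4 n3).
Local Notation pidem := (proj_idem n.+1 w3 n3).
Local Notation pbraid := (@proj_braid K w n.+1 w3 w1 n3).
Local Notation pfar := (@proj_far K w n.+1 w3 w1 n3).
Local Notation pC := (@projC K w n.+1 w3 w1 n3).

(** The scalar-free image of a word, common to all three invariants; each of them is obtained from
    its trace by powers of q and 3. *)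
Definition hecke_pair (xi : braid n.+1) : 'M[K]_N :=
  braid_image (fun i : 'I_n.+1.-1 => hecke q P false i * hecke q P true i)
    (fun i => heckeV q P false i * heckeV q P true i) xi.

Lemma pev_tl_word b (xi : braid n.+1) :
  pev (@tl_phi _ _ P b n.+1) (braid_image (@tl_g K q n.+1) (@tl_ginv K q n.+1) xi) =
  braid_image (fun i : 'I_n.+1.-1 => hecke q P b i) (fun i => heckeV q P b i) xi.
Proof.
have rel := tl_phi_rel q4 n3 pidem pfar pbraid b (leqnn n.+1).
have affE d i : pev (@tl_phi _ _ P b n.+1) (-1 + d *: tl_p q i) = affine d (P b i).
  by rewrite -[-1]scaleN1r (pevD rel) !(pevZ rel) (pev1 rel) (pev_gen rel) scaleN1r.
by rewrite (pev_braid_image _ _ _ rel); apply: eq_braid_image => i; exact: affE.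
Qed.

Lemma hecke_pairE (xi : braid n.+1) : hecke_pair xi =
  pev (@tl_phi _ _ P false n.+1) (braid_image (@tl_g K q n.+1) (@tl_ginv K q n.+1) xi) *
  pev (@tl_phi _ _ P true n.+1) (braid_image (@tl_g K q n.+1) (@tl_ginv K q n.+1) xi).
Proof.
rewrite !pev_tl_word braid_image_mul // => i j.
by split; apply: (affine_affineC pC _ _ _ _ true) => //; exact: ltn_ord.
Qed.

Lemma pev_bmw_word (xi : braid n.+1) :
  pev (@bmw_phi _ q _ P n.+1)
    (braid_image (@bmw_g K (q ^+ 3) q n.+1) (@bmw_ginv K (q ^+ 3) q n.+1) xi) =
  q ^ writhe xi *: hecke_pair xi.
Proof.
have rel := bmw_phi_rel q4 n3 pidem pC pfar pbraid (leqnn n.+1).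
rewrite (pev_braid_image _ _ _ rel) -braid_image_scale ?(q_neq0 q4) //.
by apply: eq_braid_image => i; rewrite (pev_gen rel).
Qed.

Lemma card_site : N%:R = 3%:R ^+ n.+1 :> K.
Proof. by rewrite card_ffun !card_ord natrX. Qed.

Lemma mxtrace_hecke_pair (trTL : forall k, {scalar tl q k}) (xi : braid n.+1) :
  tl_markov_trace trTL -> \tr (hecke_pair xi) =
  3%:R ^+ n.+1 * trTL n.+1 (braid_image (@tl_g K q n.+1) (@tl_ginv K q n.+1) xi) ^+ 2.
Proof.
move=> trP; rewrite hecke_pairE expr2 -card_site.
exact: (tl_trace_unique q4 n3 pidem pC pfar pbraid (@low_scalar K w n.+1)
  (@lowD K w n.+1) (@lowM K w n.+1) (@low_proj K w n.+1 w3 w1 n3)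
  (@mxtrace_proj K w n.+1 w3 w1 n3) (@mxtrace_proj2 K w n.+1 w3 w1 n3) trP).
Qed.

Lemma mxtrace_bmw_word (trBMW : forall k, {scalar bmw (q ^+ 3) q k}) (xi : braid n.+1) :
  bmw_markov_trace trBMW -> q ^ writhe xi * \tr (hecke_pair xi) =
  3%:R ^+ n.+1 * trBMW n.+1
    (braid_image (@bmw_g K (q ^+ 3) q n.+1) (@bmw_ginv K (q ^+ 3) q n.+1) xi).
Proof.
move=> trP; rewrite -mxtraceZ -pev_bmw_word -card_site.
exact: (bmw_trace_unique q4 n3 pidem pC pfar pbraid (@low_scalar K w n.+1)
  (@lowD K w n.+1) (@lowM K w n.+1) (@low_proj K w n.+1 w3 w1 n3)
  (@mxtrace_proj K w n.+1 w3 w1 n3) (@mxtrace_proj2 K w n.+1 w3 w1 n3) trP).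
Qed.

Lemma kauffmanE (trBMW : forall k, {scalar bmw (q ^+ 3) q k}) (trTL : forall k, {scalar tl q k})
    (xi : braid n.+1) : bmw_markov_trace trBMW -> tl_markov_trace trTL ->
  kauffman trBMW xi = jones trTL xi ^+ 2.
Proof.
move=> bmwP tlP; have q0 := q_neq0 q4.
have := mxtrace_bmw_word xi bmwP; rewrite (mxtrace_hecke_pair xi tlP) mulrCA.
move=> /(mulfI (expf_neq0 _ n3)) trE; rewrite /kauffman /jones -trE.
rewrite !exprMn -exprM mulnC exprM (qs2 q4) mulrA; congr (_ * _).
rewrite -mulrA; congr (_ * _).
(* One of the three factors cancels the power of q in the image of the word; the other two match the
   square of (-q^-1)^k for writhe k, where the sign disappears. *)
have q3 : (q ^+ 3) ^ (- writhe xi) = q ^ (- writhe xi) * q ^ (- writhe xi) * q ^ (- writhe xi).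
  by rewrite -!expfzDr // exprnP exprz_exp; congr (_ ^ _); lia.
rewrite q3 -mulrA -[_ * q ^ writhe xi]expfzDr // addNr expr0z mulr1 expr2 -expfzMl.
by rewrite -[RHS]expfzMl mulrNN -invfM exprz_inv.
Qed.

End PottsWords.

Lemma invmx_unique (K : fieldType) N (A B : 'M[K]_N) : A *m B = 1%:M -> invmx A = B.
Proof.
move=> AB; have [Au _] := mulmx1_unit AB.
by rewrite -[invmx A]mulmx1 -AB mulmxA mulVmx // mul1mx.
Qed.

Section RealTrace.
Variable R : realType.
Local Notation C := R[i].
Local Notation q := (qB R).

Lemma rhoR3E n (xi : braid n.+1) : rhoR3 R xi = q ^ (- writhe xi) *: hecke_pair q xi.
Proof.
have q0 := q_neq0 (@qB4 R); have n3 := three_neq0 R.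
rewrite -exprz_inv -braid_image_scale ?invr_eq0 //.
apply: eq_braid_image => i; first exact: R3_at_hecke.
rewrite invrK R3_at_hecke; apply: invmx_unique.
have wK := w_cube (@qB4 R).
have pC := @projC _ _ n.+1 wK (w_neq1 (@qB4 R) n3) n3.
have pidem := proj_idem n.+1 wK n3.
have im : (i.+1 < n.+1)%N by exact: ltn_ord.
rewrite [LHS]mx_scalerM mulVf // scale1r.
exact: (hecke_pair_inv (@qB4 R) pidem pC im).
Qed.

End RealTrace.

Theorem theorem12p8 (R : realType)
  (trBMW : forall n : nat, {scalar bmw (rB R) (qB R) n})
  (trTL : forall n : nat, {scalar tl (qB R) n})
  (htrBMW : bmw_markov_trace trBMW) (htrTL : tl_markov_trace trTL)
  (n : nat) (xi : braid n.+1) :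
  T3tilde R xi = kauffman trBMW xi /\
  kauffman trBMW xi = jones trTL xi ^+ 2.
Proof.
have q4 := @qB4 R; have n3 := three_neq0 R; have q0 := q_neq0 q4.
have KV : kauffman trBMW xi = jones trTL xi ^+ 2 by exact: kauffmanE.
split=> //; rewrite KV /T3tilde /T3 rhoR3E mxtraceZ (mxtrace_hecke_pair q4 n3 xi htrTL).
rewrite /jones !exprMn -exprM mulnC exprM (qs2 q4) exprS.
(* Of the two powers of q on the right, one normalizes [T3] and the other comes from the factor q^-1
   in R_3. *)
have -> : ((- (qB R)^-1) ^ writhe xi) ^+ 2 = qB R ^ (- writhe xi) * qB R ^ (- writhe xi).
  by rewrite expr2 -[LHS]expfzMl mulrNN expfzMl !exprz_inv.
by field.
Qed.
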